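(* Let $K$ be a field, let $G$ be a graph on the vertex set $[n]=\{1,\ldots,n\}$, and let $\mathcal{J}_G$ be the binomial edge ideal of $G$ in $R=K[x_1,\ldots,x_n,y_1,\ldots,y_n]$. Let $\alpha=\max\{c(S)-|S| : S\subseteq[n]\}$ and $\mathcal{A}=\{S\subseteq[n] : c(S)-|S|=\alpha\}$. For $S\in\mathcal{A}$, let $B_{S,1},\ldots,B_{S,j_S}$ be the connected components of the graph induced by $G$ on $[n]\setminus S$, and let $|B_{S,r}|$ denote the number of vertices of $B_{S,r}$. Then $$\operatorname{e}(R/\mathcal{J}_G)=\sum_{S\in\mathcal{A}}\ \prod_{r=1}^{j_S}|B_{S,r}|,$$ and, if $K$ has positive characteristic, $$\operatorname{e}_{HK}(R/\mathcal{J}_G)=\sum_{S\in\mathcal{A}}\ \prod_{r=1}^{j_S}\left(\frac{|B_{S,r}|}{2}+\frac{|B_{S,r}|}{(|B_{S,r}|+1)!}\right).$$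
   Context: All graphs are simple and undirected. For a graph $G$ on $[n]$, the binomial edge ideal is $\mathcal{J}_G=(x_iy_j-x_jy_i : \{i,j\} \text{ an edge of } G)\subseteq R$. For $S\subseteq[n]$, $c(S)$ is the number of connected components of the induced subgraph $G\setminus S$ on $[n]\setminus S$. For a standard graded $K$-algebra $T$ of dimension $d$ with maximal homogeneous ideal $\mathfrak{n}$, the Hilbert-Samuel multiplicity is $\operatorname{e}(T)=\lim_{r\to\infty}\frac{d!\,\dim_K(T/\mathfrak{n}^r)}{r^d}$. If $K$ has prime characteristic $p$, the Hilbert-Kunz multiplicity is $\operatorname{e}_{HK}(T)=\lim_{e\to\infty}\frac{\dim_K(T/\mathfrak{n}^{[p^e]})}{p^{ed}}$, where $\mathfrak{n}^{[p^e]}=(f^{p^e} : f\in\mathfrak{n})T$. The ring $R/\mathcal{J}_G$ is standard graded with all variables in degree $1$. *)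

(* Defs.v *)
From HB Require Import structures.
From mathcomp Require Import all_boot all_order all_algebra.
From mathcomp Require Import generic_quotient ring_quotient.
(* mpoly has to be imported before topology: in the other order their
   notation levels clash. *)
From mathcomp Require Import mpoly.
From mathcomp Require Import boolp classical_sets reals topology normedtype.
From mathcomp Require Import sequences.

Set Implicit Arguments.
Unset Strict Implicit.
Unset Printing Implicit Defensive.

Import Order.TTheory GRing.Theory Num.Theory numFieldNormedType.Exports.
Local Open Scope ring_scope.
Local Open Scope classical_set_scope.
Local Open Scope quotient_scope.

Section QuotientAlgebra.
Variables (K : fieldType) (A : comAlgType K) (I : idealr A).

Definition quot_scale (c : K) (x : {ideal_quot I}) : {ideal_quot I} :=
  \pi_{ideal_quot I} c%:A * x.

Lemma quot_scalerA a b x :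
  quot_scale a (quot_scale b x) = quot_scale (a * b) x.
Proof. by rewrite /quot_scale mulrA -rmorphM /= -scalerAl mul1r scalerA. Qed.

Lemma quot_scale1r : left_id 1 quot_scale.
Proof. by move=> x; rewrite /quot_scale scale1r rmorph1 mul1r. Qed.

Lemma quot_scalerDr : right_distributive quot_scale +%R.
Proof. by move=> c x y; rewrite /quot_scale mulrDr. Qed.

Lemma quot_scalerDl x : {morph quot_scale^~ x : a b / a + b}.
Proof. by move=> a b; rewrite /quot_scale scalerDl rmorphD mulrDl. Qed.

HB.instance Definition _ := GRing.Zmodule_isLmodule.Build K (Quotient.quot I)
  quot_scalerA quot_scale1r quot_scalerDr quot_scalerDl.

Lemma quot_scalerAl (c : K) (x y : {ideal_quot I}) :
  c *: (x * y) = (c *: x) * y.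
Proof. exact: mulrA. Qed.

HB.instance Definition _ :=
  GRing.Lmodule_isLalgebra.Build K (Quotient.quot I) quot_scalerAl.
HB.instance Definition _ :=
  GRing.Lalgebra_isComAlgebra.Build K (Quotient.quot I).

End QuotientAlgebra.

Section Multiplicities.
Variables (K : fieldType) (T : comAlgType K).
Implicit Types (I m : set T) (r q d : nat).

Definition ideal_gen (X : set T) : set T :=
  [set f | exists2 s : seq (T * T),
     (forall u, u \in s -> X u.2) & f = \sum_(u <- s) u.1 * u.2].

Definition ideal_expn I r : set T :=
  ideal_gen [set f | exists2 g : 'I_r -> T,
    (forall i, I (g i)) & f = \prod_(i < r) g i].

Definition frobenius_power I q : set T := ideal_gen [set f ^+ q | f in I].

(* dim_K (T / I) = d: the classes modulo I of some b_0, ..., b_(d-1) form a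
   K-basis of T / I. *)
Definition is_quotient_dim I d : Prop :=
  exists b : 'I_d -> T,
    (forall f, exists c : 'I_d -> K, I (f - \sum_(i < d) c i *: b i)) /\
    (forall c : 'I_d -> K,
       I (\sum_(i < d) c i *: b i) -> forall i, c i = 0).

Definition has_prime_chain d : Prop :=
  exists P : 'I_d.+1 -> prime_idealr T, forall i j : 'I_d.+1, (i < j)%N ->
    {subset P i <= P j} /\ ~ {subset P j <= P i}.

Definition is_krull_dim d : Prop :=
  has_prime_chain d /\ forall d', has_prime_chain d' -> (d' <= d)%N.

(* The invariants e(T) and e_HK(T) relative to an ideal m of T are relations
   rather than total functions, so that the existence of the Krull dimension,
   of the lengths and of the limit is part of each assertion. *)
Definition is_hilbert_samuel_mult (F : realType) m (e : F) : Prop :=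
  exists2 d, is_krull_dim d &
  exists2 l : nat -> nat, forall r, is_quotient_dim (ideal_expn m r) (l r) &
    (fun r => (d`! * l r)%:R / r%:R ^+ d : F) @ \oo --> e.

Definition is_hilbert_kunz_mult (p : nat) (F : realType) m (e : F) : Prop :=
  exists2 d, is_krull_dim d &
  exists2 l : nat -> nat,
    forall k, is_quotient_dim (frobenius_power m (p ^ k)) (l k) &
    (fun k => (l k)%:R / p%:R ^+ (k * d) : F) @ \oo --> e.

End Multiplicities.

Section BinomialEdgeIdeal.
Variables (K : fieldType) (n : nat) (adj : rel 'I_n).

Definition xvar (i : 'I_n) : {mpoly K[n + n]} := 'X_(lshift n i).
Definition yvar (i : 'I_n) : {mpoly K[n + n]} := 'X_(rshift n i).

Definition binomial_edge_ideal : set {mpoly K[n + n]} :=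
  ideal_gen [set f | exists i j : 'I_n,
    adj i j /\ f = xvar i * yvar j - xvar j * yvar i].

Definition in_binomial_edge_ideal (f : {mpoly K[n + n]}) : bool :=
  `[< binomial_edge_ideal f >].

Lemma binomial_edge_ideal_closed : idealr_closed in_binomial_edge_ideal.
Proof.
split.
- by apply/asboolP; exists [::]; rewrite ?big_nil.
- apply/negP => /asboolP[s sJ /(congr1 (meval (fun=> 0)))].
  rewrite rmorph1 raddf_sum /= big_seq big1.
    by move/eqP; rewrite oner_eq0.
  move=> u us; have [i [j [_ ->]]] := sJ _ us.
  by rewrite /xvar /yvar mevalM mevalB !mevalM !mevalXU !mulr0 subr0 mulr0.
- move=> a f g /asboolP[s sJ ->] /asboolP[t tJ ->]; apply/asboolP.
  exists ([seq (a * u.1, u.2) | u <- s] ++ t).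
    move=> u; rewrite mem_cat => /orP[/mapP[v vs ->]|]; last exact: tJ.
    exact: (sJ v vs).
  rewrite big_cat big_map mulr_sumr /=; congr (_ + _).
  by apply: eq_bigr => u _; rewrite mulrA.
Qed.

HB.instance Definition _ :=
  isIdealr.Build _ in_binomial_edge_ideal binomial_edge_ideal_closed.

Definition binomial_edge_idealr : idealr {mpoly K[n + n]} :=
  in_binomial_edge_ideal.

Definition binomial_edge_ring : comAlgType K :=
  {ideal_quot binomial_edge_idealr}.

(* The maximal homogeneous ideal of R / J_G for the standard grading. *)
Definition binomial_edge_max : set binomial_edge_ring :=
  ideal_gen [set \pi_{ideal_quot binomial_edge_idealr} 'X_k
            | k in [set: 'I_(n + n)]].

End BinomialEdgeIdeal.

Arguments binomial_edge_max K {n} adj _.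

Section Graph.
Variables (n : nat) (adj : rel 'I_n).
Implicit Types S : {set 'I_n}.

Definition adj_minus S : rel 'I_n :=
  [rel i j | [&& i \notin S, j \notin S & adj i j]].

Definition components S : {set {set 'I_n}} :=
  equivalence_partition (connect (adj_minus S)) (~: S).

(* c(S) - |S|, which may be negative *)
Definition excess S : int := #|components S|%:Z - #|S|%:Z.

(* The starting value of the maximum is itself one of the values. *)
Definition alpha : int :=
  \big[Order.max/excess finset.set0]_(S : {set 'I_n}) excess S.

Definition max_excess_sets : {set {set 'I_n}} :=
  [set S | excess S == alpha]%SET.

End Graph.

(* Main.v *)
(** Two monomials agree modulo the binomial edge ideal as soon as they have the
    same degree at every vertex and the same total y-degree on every connected
    component of their support: factors y move along the edges as the particles
    of an exclusion process. Conversely, these data are read off from the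
    parametrizations x_i = s_i, y_i = s_i u_c for i outside a set S, where c is
    the component of i, while the variables of S are sent to 0. Hence the classes
    of monomials form a basis of the ring, and the powers and Frobenius powers of
    the maximal ideal are spanned by classes, so that all lengths are obtained by
    counting pairs of vertex degrees and component y-degrees.

    For vertex degrees with zero set S the count factors over the components B:
    for ordinary powers through the generating function (z (z / (1 - z))^|B|)',
    whose pole at 1 has leading part |B| / (1 - z)^(|B| + 1), and for Frobenius powers with s = |B| through the exact value
    (q - 1)^s (1 + s q / 2) + s 'C(q, s + 1). The order of growth of the S-part is
    n - |S| + c(S), which is maximal exactly for the sets S of maximal excess.

    This maximum is also the Krull dimension. Setting the variables u_c and then
    the s_i to 0 one after the other gives a chain of kernels of this length.
    For a chain P_0 < ... < P_d' and f_i in P_i but not in P_(i-1), the monomials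
    in the f_i with exponents at most k are linearly independent modulo P_0, so
    (k + 1)^d' is at most a length of order k^d. *)

Require Import Defs.
From HB Require Import structures.
From mathcomp Require Import all_boot all_order all_algebra.
From mathcomp Require Import generic_quotient ring_quotient.
From mathcomp Require Import mpoly.
From mathcomp Require Import boolp classical_sets reals topology normedtype.
From mathcomp Require Import sequences.
From mathcomp Require Import zify.

Set Implicit Arguments.
Unset Strict Implicit.
Unset Printing Implicit Defensive.

Import Order.TTheory GRing.Theory Num.Theory numFieldNormedType.Exports.
Local Open Scope ring_scope.

(** * Normal forms of monomials and the coordinate functionals dual to them *)

Section EdgeClasses.

Variables (K : fieldType) (n : nat) (adj : rel 'I_n).
Hypothesis adj_sym : ssrbool.symmetric adj.

Implicit Types (m : 'X_{1..n + n}) (S : {set 'I_n}) (D : {set 'I_(n + n)}).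
Implicit Types (i j : 'I_n) (f : {mpoly K[n + n]}).

Local Notation T := (binomial_edge_ring K adj).

Definition edge_pi (f : {mpoly K[n + n]}) : T :=
  \pi_{ideal_quot (binomial_edge_idealr K adj)}%qT f.

Lemma edge_pi_zmod_morphism : zmod_morphism edge_pi.
Proof. by move=> f g; rewrite /edge_pi rmorphB. Qed.

Lemma edge_pi_monoid_morphism : monoid_morphism edge_pi.
Proof.
split=> [|f g]; first exact: (rmorph1 (\pi_{ideal_quot (binomial_edge_idealr K adj)}%qT)).
exact: (rmorphM (\pi_{ideal_quot (binomial_edge_idealr K adj)}%qT)).
Qed.

Lemma edge_pi_scalable : scalable edge_pi.
Proof. by move=> c f; rewrite -mulr_algl /edge_pi rmorphM. Qed.

HB.instance Definition _ := GRing.isZmodMorphism.Build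
  {mpoly K[n + n]} (binomial_edge_ring K adj) edge_pi edge_pi_zmod_morphism.
HB.instance Definition _ := GRing.isMonoidMorphism.Build
  {mpoly K[n + n]} (binomial_edge_ring K adj) edge_pi edge_pi_monoid_morphism.
HB.instance Definition _ := GRing.isScalable.Build K
  {mpoly K[n + n]} (binomial_edge_ring K adj) *:%R edge_pi edge_pi_scalable.

Lemma edge_pi_repr x : edge_pi (repr x) = x.
Proof. exact: reprK. Qed.

Local Notation pr := edge_pi.

Definition vdeg m i := (m (lshift n i) + m (rshift n i))%N.
Definition vzero m : {set 'I_n} := [set i | vdeg m i == 0%N]%SET.
(** A vertex of [S] meets no edge of [adj_minus adj S], hence is its own representative. *)
Definition rep S i := fingraph.root (adj_minus adj S) i.

Lemma adj_minus_sym S : connect_sym (adj_minus adj S).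
Proof.
by apply: sym_connect_sym => i j; rewrite /adj_minus /= adj_sym andbCA.
Qed.

Lemma repP S i j : reflect (rep S i = rep S j) (connect (adj_minus adj S) i j).
Proof. exact: (fingraph.rootP (adj_minus_sym S)). Qed.

Lemma connect_notin S i j :
  connect (adj_minus adj S) i j -> i \notin S -> j \notin S.
Proof.
case/connectP=> p; elim: p i => [|k p IHp] i /=; first by move=> _ ->.
by case/andP=> /and3P[_ kS _] pth jE _; exact: IHp pth jE kS.
Qed.

Lemma rep_notin S i : (rep S i \notin S) = (i \notin S).
Proof.
have c := connect_root (adj_minus adj S) i.
apply/idP/idP; last exact: connect_notin c.
by apply: connect_notin; rewrite adj_minus_sym.
Qed.

(* The normal form keeps the vertex degrees and, for every component of the
   support, the total degree in the y-variables, stored at the representative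
   of the component. *)
Definition nform_at S m : 'X_{1..n + n} :=
  (\sum_i (U_(lshift n i) *+ vdeg m i +
           U_(rshift n (rep S i)) *+ m (rshift n i)))%MM.
Definition nform m := nform_at (vzero m) m.

Lemma nform_atx S m j : nform_at S m (lshift n j) = vdeg m j.
Proof.
rewrite mnm_sumE (bigD1 j) //= big1 => [|i /negbTE ij].
  by rewrite addn0 mnmDE !mulmnE !mnm1E eqxx eq_rlshift mul1n mul0n addn0.
by rewrite mnmDE !mulmnE !mnm1E eq_lshift ij eq_rlshift !mul0n.
Qed.

Lemma nform_aty S m j :
  nform_at S m (rshift n j) = (\sum_(i | rep S i == j) m (rshift n i))%N.
Proof.
rewrite mnm_sumE [RHS]big_mkcond; apply: eq_bigr => i _.
rewrite mnmDE !mulmnE !mnm1E eq_lrshift eq_rshift mul0n add0n.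
by case: eqP; rewrite ?mul1n ?mul0n.
Qed.

Lemma eq_mnm_split (m1 m2 : 'X_{1..n + n}) :
  (forall i, m1 (lshift n i) = m2 (lshift n i)) ->
  (forall i, m1 (rshift n i) = m2 (rshift n i)) -> m1 = m2.
Proof.
by move=> eqx eqy; apply/mnmP => k; case: (splitP k) => i ki;
   [move: (eqx i) | move: (eqy i)]; congr (m1 _ = m2 _); apply: val_inj.
Qed.

Lemma mdeg_split m : mdeg m = (\sum_i vdeg m i)%N.
Proof. by rewrite mdegE big_split_ord /= -big_split. Qed.

Lemma nform_vdeg m1 m2 : nform m1 = nform m2 -> vdeg m1 =1 vdeg m2.
Proof. by move=> e i; rewrite -(nform_atx (vzero m1)) -/(nform m1) e nform_atx. Qed.

Lemma eq_vzero m1 m2 : vdeg m1 =1 vdeg m2 -> vzero m1 = vzero m2.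
Proof. by move=> e; apply/setP => i; rewrite !inE e. Qed.

(** The x-exponents of [nform_at S m] are the vertex degrees of [m] whatever [S] is, so the equality
    already forces equal zero sets. *)
Lemma nform_at_eq m1 m2 S :
  S = vzero m1 -> nform_at S m2 = nform m1 -> nform m2 = nform m1.
Proof.
move=> ->; rewrite /nform => e.
suff -> : vzero m2 = vzero m1 by [].
apply: eq_vzero => i; by rewrite -(nform_atx (vzero m1)) e nform_atx.
Qed.

(** [D] is kept apart from [S]: the coordinate functionals kill only the [s_i] with i in [S], while
    the chain of primes kills further variables. *)
Definition kill D (k : 'I_(n + n)) : {mpoly K[n + n]} :=
  if k \in D then 0 else 'X_k.

(* The parametrization x_i = s_i, y_i = s_i u_c, with c the component of i,
   after the variables in D have been set to 0. *)
Definition edge_param S D (k : 'I_(n + n)) : {mpoly K[n + n]} :=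
  match fintype.split k with
  | inl i => kill D (lshift n i)
  | inr i => kill D (lshift n i) * kill D (rshift n (rep S i))
  end.

Definition edge_sub S D : {mpoly K[n + n]} -> {mpoly K[n + n]} :=
  mmap (@mpolyC (n + n) K) (edge_param S D).

HB.instance Definition _ S D := GRing.RMorphism.on (edge_sub S D).

Lemma edge_subX S D m :
  edge_sub S D 'X_[m] = (\prod_i kill D (lshift n i) ^+ vdeg m i) *
                        \prod_i kill D (rshift n (rep S i)) ^+ m (rshift n i).
Proof.
rewrite /edge_sub mmapX /mmap1 big_split_ord /= -!big_split /=.
apply: eq_bigr => i _; rewrite /edge_param.
rewrite (unsplitK (inl i)) (unsplitK (inr i)) /= exprMn exprD.
by rewrite mulrA.
Qed.

Lemma edge_subZ S D (c : K) f : edge_sub S D (c *: f) = c *: edge_sub S D f.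
Proof. by rewrite /edge_sub mmapZ mul_mpolyC. Qed.

Lemma edge_sub_xvar S D i : edge_sub S D (xvar K i) = kill D (lshift n i).
Proof.
rewrite /edge_sub /xvar mmapX mmap1U /edge_param.
by rewrite (unsplitK (inl i)).
Qed.

Lemma edge_sub_yvar S D i :
  edge_sub S D (yvar K i) = kill D (lshift n i) * kill D (rshift n (rep S i)).
Proof.
rewrite /edge_sub /yvar mmapX mmap1U /edge_param.
by rewrite (unsplitK (inr i)).
Qed.

(** A generator maps to [s_i s_j] times a difference of two [u] variables. If i or j lies in [S],
    the first factor is 0; otherwise the edge puts i and j in one component and the difference is
    0. *)
Lemma edge_sub_ideal S D f : (forall i, i \in S -> lshift n i \in D) ->
  binomial_edge_ideal adj f -> edge_sub S D f = 0.
Proof.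
move=> SD [s sJ ->]; rewrite rmorph_sum big_seq big1 // => u us.
have [i [j [ij ->]]] := sJ _ us; rewrite rmorphM rmorphB !rmorphM.
rewrite /= !edge_sub_xvar !edge_sub_yvar.
have kS k : k \in S -> kill D (lshift n k) = 0 by move=> /SD kD; rewrite /kill kD.
have [/kS->|iS] := boolP (i \in S); first by rewrite !(mul0r, mulr0) subr0 mulr0.
have [/kS->|jS] := boolP (j \in S); first by rewrite !(mul0r, mulr0) subr0 mulr0.
have -> : rep S i = rep S j.
  by apply/repP/connect1; rewrite /adj_minus /= iS jS.
by rewrite !mulrA [_ * kill D (lshift n i)]mulrC subrr mulr0.
Qed.

Lemma pr_eqP f g : pr f = pr g <-> binomial_edge_ideal adj (f - g).
Proof.
by split=> [/eqP|fJ]; [rewrite /edge_pi -Quotient.idealrBE => /asboolP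
  | apply/eqP; rewrite /edge_pi -Quotient.idealrBE; apply/asboolP].
Qed.

Lemma pr_swap i j : adj i j -> pr (xvar K i * yvar K j) = pr (xvar K j * yvar K i).
Proof.
move=> ij; apply/pr_eqP.
exists [:: (1, xvar K i * yvar K j - xvar K j * yvar K i)].
  by move=> u; rewrite inE => /eqP -> /=; exists i, j.
by rewrite big_seq1 mul1r.
Qed.

(** The functional dual to the class of [m]: by [class_coef_ideal] it descends to the quotient ring,
    and by [class_coefX] it separates [m] from all monomials with another normal form. *)
Definition class_coef m f : K :=
  (edge_sub (vzero m) [set lshift n i | i in vzero m] f)@_(nform m).

Lemma class_coef_ideal m f : binomial_edge_ideal adj f -> class_coef m f = 0.
Proof.
move=> fJ; rewrite /class_coef edge_sub_ideal ?mcoeff0 // => i iS.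
exact: imset_f.
Qed.

Lemma class_coefZ m c f : class_coef m (c *: f) = c * class_coef m f.
Proof. by rewrite /class_coef edge_subZ mcoeffZ. Qed.

Lemma class_coef_sum m (I : Type) (r : seq I) (P : pred I) (F : I -> {mpoly K[n + n]}) :
  class_coef m (\sum_(k <- r | P k) F k) = \sum_(k <- r | P k) class_coef m (F k).
Proof. by rewrite /class_coef rmorph_sum /= raddf_sum. Qed.

Lemma class_coefB m f g : class_coef m (f - g) = class_coef m f - class_coef m g.
Proof. by rewrite /class_coef rmorphB mcoeffB. Qed.

Lemma edge_sub_mon S m :
  edge_sub S [set lshift n i | i in S] 'X_[m] =
  if [forall (i | i \in S), vdeg m i == 0%N] then 'X_[nform_at S m] else 0.
Proof.
have killx i : kill [set lshift n i | i in S] (lshift n i) =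
    if i \in S then 0 else 'X_(lshift n i).
  by rewrite /kill mem_imset //; apply: lshift_inj.
have killy i : kill [set lshift n i | i in S] (rshift n i) = 'X_(rshift n i).
  rewrite /kill ifN //; apply/imsetP => -[j _ /eqP].
  by rewrite eq_rlshift.
rewrite edge_subX; case: ifPn => [/forall_inP m0|].
  rewrite -mprodXE -big_split; apply: eq_bigr => i _ /=.
  rewrite killx killy mpolyXD; congr (_ * _); last by rewrite mpolyXn.
  case: ifP => [iS|_]; last by rewrite mpolyXn.
  by rewrite (eqP (m0 _ iS)) mulm0n mpolyX0.
rewrite negb_forall_in => /exists_inP[i iS mi]; rewrite (bigD1 i) //=.
by rewrite killx iS expr0n (negbTE mi) !mul0r.
Qed.

(** A monomial that survives the substitution may still have a zero set larger than that of [m];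
    when its image is [nform m], this is excluded by [nform_at_eq]. *)
Lemma class_coefX m m' : class_coef m 'X_[m'] = (nform m' == nform m)%:R.
Proof.
rewrite /class_coef edge_sub_mon; case: ifPn => [/forall_inP m0|].
  suff e : (nform_at (vzero m) m' == nform m) = (nform m' == nform m).
    by rewrite mcoeffX; exact: (congr1 (fun b : bool => b%:R : K) e).
  apply/eqP/eqP => e; first exact: nform_at_eq e.
  by rewrite -e /nform (eq_vzero (nform_vdeg e)).
rewrite negb_forall_in mcoeff0 => /exists_inP[i iS mi].
suff /negbTE -> : nform m' != nform m by [].
apply: contra mi => /eqP e; rewrite (nform_vdeg e).
by move: iS; rewrite inE.
Qed.

Lemma class_coefE m f :
  class_coef m f = \sum_(m' <- msupp f) f@_m' * (nform m' == nform m)%:R.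
Proof.
rewrite {1}[f]mpolyE class_coef_sum; apply: eq_bigr => m' _.
by rewrite class_coefZ class_coefX.
Qed.

End EdgeClasses.

(** * Monomials with equal normal forms agree in the ring *)

Section ClassBasis.

Variables (K : fieldType) (n : nat) (adj : rel 'I_n).
Hypothesis adj_sym : ssrbool.symmetric adj.

Implicit Types (m : 'X_{1..n + n}) (S : {set 'I_n}).
Implicit Types (a b : 'I_n -> nat) (i j : 'I_n) (f : {mpoly K[n + n]}).

Local Notation T := (binomial_edge_ring K adj).
Local Notation pr := (@edge_pi K n adj).

(** Here [a] prescribes the vertex degrees and [b] the y-exponents; the truncated subtraction is
    exact when [b] is at most [a]. *)
Definition mono a b : 'X_{1..n + n} :=
  [multinom match fintype.split k with inl i => (a i - b i)%N | inr i => b i end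
  | k < n + n].

Lemma mono_x a b i : mono a b (lshift n i) = (a i - b i)%N.
Proof. by rewrite mnmE (unsplitK (inl i)). Qed.

Lemma mono_y a b i : mono a b (rshift n i) = b i.
Proof. by rewrite mnmE (unsplitK (inr i)). Qed.

Lemma vdeg_mono a b i : (b i <= a i)%N -> vdeg (mono a b) i = a i.
Proof. by move=> le_ba; rewrite /vdeg mono_x mono_y subnK. Qed.

Lemma eq_mono a a' b b' : a =1 a' -> b =1 b' -> mono a b = mono a' b'.
Proof. by move=> ea eb; apply: eq_mnm_split => i; rewrite ?mono_x ?mono_y ?ea ?eb. Qed.

Lemma mono_vdeg m : mono (vdeg m) (fun i => m (rshift n i)) = m.
Proof. by apply: eq_mnm_split => i; rewrite ?mono_x ?mono_y ?addnK. Qed.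

(* Think of b i <= a i as the number of tokens on a site of capacity a i. *)
Definition transfer i j b : 'I_n -> nat := fun k => (b k + (k == j) - (k == i))%N.

Lemma transfer_le a b i j : (forall k, b k <= a k)%N -> (b j < a j)%N ->
  (forall k, transfer i j b k <= a k)%N.
Proof.
move=> le_ba lt_bj k; rewrite /transfer.
by case: eqVneq => [->|_]; move: (le_ba k); lia.
Qed.

Lemma pr_transfer_adj a b i j : (forall k, b k <= a k)%N ->
  adj i j -> (0 < b i)%N -> (b j < a j)%N ->
  pr 'X_[mono a b] = pr 'X_[mono a (transfer i j b)].
Proof.
move=> le_ba ij bi bj; have [<-|ne_ij] := eqVneq i j.
  congr (pr 'X_[_]); apply: eq_mono => // k; rewrite /transfer; lia.
(* The common cofactor: the monomials are [x_j y_i c] and [x_i y_j c], so that [pr_swap] applies. *)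
pose c := (mono a b - U_(rshift n i) - U_(lshift n j))%MM.
have e1 : mono a b = (U_(lshift n j) + U_(rshift n i) + c)%MM.
  apply: eq_mnm_split => k; rewrite !mnmDE !mnmBE !mnm1E ?mono_x ?mono_y
     ?eq_lshift ?eq_rshift ?eq_lrshift ?eq_rlshift //.
    by case: eqVneq => [<-|]; move: bj; lia.
  by case: eqVneq => [<-|]; move: bi; lia.
have e2 : mono a (transfer i j b) = (U_(lshift n i) + U_(rshift n j) + c)%MM.
  apply: eq_mnm_split => k; rewrite !mnmDE !mnmBE !mnm1E ?mono_x ?mono_y
     ?eq_lshift ?eq_rshift ?eq_lrshift ?eq_rlshift /transfer ![k == _]eq_sym.
    move: ne_ij bi bj (le_ba k).
    by case: (eqVneq i k) => [->|_]; case: (eqVneq j k) => [->|_]; rewrite ?eqxx //=; lia.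
  move: ne_ij bi bj (le_ba k).
  by case: (eqVneq i k) => [->|_]; case: (eqVneq j k) => [->|_]; rewrite ?eqxx //=; lia.
rewrite e1 e2 ![in LHS]mpolyXD ![in RHS]mpolyXD !rmorphM /=.
congr (_ * _); rewrite -!rmorphM.
exact/esym/pr_swap.
Qed.

(** Induction along the path. Positive capacity off [S] ensures that a full site holds a token,
    which can be passed on before the new one arrives. *)
Lemma pr_transfer_path S a b i p :
  (forall k, k \notin S -> 0 < a k)%N -> (forall k, b k <= a k)%N ->
  path (adj_minus adj S) i p -> (0 < b i)%N ->
  (b (last i p) < a (last i p))%N ->
  pr 'X_[mono a b] = pr 'X_[mono a (transfer i (last i p) b)].
Proof.
move=> a_gt0; elim: p i b => [|k p IHp] i b le_ba /=.
  by move=> _ bi ba; congr (pr 'X_[_]); apply: eq_mono => // x; rewrite /transfer addnK.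
case/andP=> /and3P[iS kS ik] pth bi; set j := last k p => bj.
have IHk c (le_ca : (forall x, c x <= a x)%N) (ck : (0 < c k)%N) :
    (c j < a j)%N -> pr 'X_[mono a c] = pr 'X_[mono a (transfer k j c)].
  exact: IHp le_ca pth ck.
have [eik|nik] := eqVneq i k.
  by rewrite [in RHS]eik; apply: IHk => //; rewrite -?eik.
have [ekj|nkj] := eqVneq k j.
  by rewrite -ekj; apply: pr_transfer_adj; rewrite // ekj.
(* If k is full, its token is sent to j before k is refilled from i. *)
have [bk|bk] := ltnP (b k) (a k).
  rewrite (pr_transfer_adj le_ba ik bi bk) IHk; last 3 first.
  - exact: transfer_le.
  - by rewrite /transfer eqxx [k == i]eq_sym (negbTE nik) subn0 addn1.
  - rewrite /transfer [j == k]eq_sym (negbTE nkj) addn0.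
    exact: leq_ltn_trans (leq_subr _ _) bj.
  congr (pr 'X_[_]); apply: eq_mono => // x; rewrite /transfer.
  move: bi nik nkj.
  case: (eqVneq x i) => [xi|_]; first rewrite -?xi;
  (case: (eqVneq x k) => [xk|_]; first rewrite -?xk);
  (case: (eqVneq x j) => [xj|_]; first rewrite -?xj); rewrite ?eqxx //; lia.
have bk0 : (0 < b k)%N by apply: leq_trans (a_gt0 k kS) bk.
rewrite (IHk b) //.
rewrite (@pr_transfer_adj a _ i k) //; last 3 first.
- exact: transfer_le.
- by rewrite /transfer (negbTE nik) subn0 ltn_addr.
- rewrite /transfer eqxx (negbTE nkj) addn0.
  by move: (le_ba k) bk0; lia.
congr (pr 'X_[_]); apply: eq_mono => // x; rewrite /transfer.
move: bi bk0 nik nkj.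
case: (eqVneq x i) => [xi|_]; first rewrite -?xi;
  (case: (eqVneq x k) => [xk|_]; first rewrite -?xk);
  (case: (eqVneq x j) => [xj|_]; first rewrite -?xj); rewrite ?eqxx //; lia.
Qed.

Lemma sum_transfer (P : pred 'I_n) b i j : P i -> P j -> (0 < b i)%N ->
  (\sum_(k | P k) transfer i j b k = \sum_(k | P k) b k)%N.
Proof.
move=> Pi Pj bi; have [<-|nij] := eqVneq i j.
  by apply: eq_bigr => k _; rewrite /transfer addnK.
rewrite (bigD1 i) // (bigD1 j) /=; last by rewrite Pj eq_sym.
rewrite [in RHS](bigD1 i) // [in RHS](bigD1 j) /=; last by rewrite Pj eq_sym.
rewrite (eq_bigr b) => [|k /andP[/andP[_ ki] kj]]; last first.
  by rewrite /transfer (negbTE ki) (negbTE kj) addn0 subn0.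
rewrite /transfer !eqxx [j == i]eq_sym (negbTE nij); move: bi; lia.
Qed.

(** Induction on the total excess of [b] over [b']. A site where [b] is too large is matched, by
    equality of the component sums, with a site of the same component where [b] is too small; moving
    one token between them lowers the excess. Without excess, equal sums force [b = b']. *)
Lemma pr_mono_eq S a b b' :
  (forall k, k \notin S -> 0 < a k)%N ->
  (forall k, b k <= a k)%N -> (forall k, b' k <= a k)%N ->
  (forall i, \sum_(k | rep adj S k == rep adj S i) b k =
             \sum_(k | rep adj S k == rep adj S i) b' k)%N ->
  pr 'X_[mono a b] = pr 'X_[mono a b'].
Proof.
move=> a_gt0 le_ba le_b'a; have [N] := ubnP (\sum_k (b k - b' k))%N.
elim: N b le_ba => // N IHN b le_ba ltN eqs.
have [/existsP[i bi]|/existsPn le_bb'] := boolP [exists i, b' i < b i]%N; last first.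
  congr (pr 'X_[_]); apply: eq_mono => // i.
  have le k : rep adj S k == rep adj S i -> (b k <= b' k ?= iff (b k == b' k))%N.
    by move=> _; split=> //; rewrite leqNgt.
  have [_] := leqif_sum le; rewrite eqs eqxx => /esym/forall_inP bb'.
  by apply/eqP; apply: bb'.
have [/existsP[j /andP[/eqP ij bj]]|/existsPn no_j] :=
    boolP [exists j, (rep adj S j == rep adj S i) && (b j < b' j)]%N; last first.
  exfalso; have := eqs i; rewrite (bigD1 i) //= [in RHS](bigD1 i) //= => e.
  suff le : (\sum_(k | (rep adj S k == rep adj S i) && (k != i)) b' k <=
          \sum_(k | (rep adj S k == rep adj S i) && (k != i)) b k)%N.
    by have := leq_add bi le; rewrite e addSn ltnn.
  apply: leq_sum => k /andP[ki _]; move: (no_j k); rewrite ki /=.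
  by rewrite -leqNgt.
have b_gt0 : (0 < b i)%N by apply: leq_ltn_trans bi.
have bja : (b j < a j)%N by apply: leq_trans bj (le_b'a j).
have /connectP[p pth jE] : connect (adj_minus adj S) i j.
  by apply/(repP adj_sym).
rewrite (@pr_transfer_path S a b i p) -?jE //; apply: IHN.
- exact: transfer_le.
- have nij : i != j by apply: contraTneq bi => ->; rewrite -leqNgt ltnW.
  rewrite -ltnS; apply: leq_ltn_trans ltN.
  rewrite [X in (X < _)%N](bigD1 i) //= [X in (_ < X)%N](bigD1 i) //= -addSn.
  apply: leq_add.
    by rewrite /transfer eqxx (negbTE nij); move: bi; lia.
  apply: leq_sum => k ki; rewrite /transfer (negbTE ki) subn0.
  by case: eqVneq => [->|_]; move: bj; lia.
- move=> k; rewrite -eqs; have [e|ne] := eqVneq (rep adj S i) (rep adj S k).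
    by apply: sum_transfer; rewrite // ?ij e.
  apply: eq_bigr => x /eqP xk; rewrite /transfer.
  case: eqVneq => [xj|_]; first by rewrite -ij -xj xk eqxx in ne.
  by case: eqVneq => [xi|_]; [rewrite -xi xk eqxx in ne | rewrite addn0 subn0].
Qed.

Lemma pr_nform m m' : nform adj m = nform adj m' -> pr 'X_[m] = pr 'X_[m'].
Proof.
move=> e; rewrite -(mono_vdeg m) -(mono_vdeg m').
have ev := nform_vdeg e.
rewrite (_ : mono (vdeg m') _ = mono (vdeg m) (fun i => m' (rshift n i))); last first.
  by apply: eq_mono => // i; rewrite ev.
apply: (@pr_mono_eq (vzero m)) => [k|k|k|i].
- by rewrite inE -lt0n.
- exact: leq_addl.
- by rewrite ev; exact: leq_addl.
move: e => /(congr1 (fun u : 'X_{1..n + n} => u (rshift n (rep adj (vzero m) i)))).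
by rewrite /nform -(eq_vzero ev) !nform_aty.
Qed.

End ClassBasis.

(** * Closure properties of generated ideals *)

Section IdealGen.

Variables (K : fieldType) (T : comAlgType K).
Implicit Types X : set T.

Lemma ideal_genD X x y : ideal_gen X x -> ideal_gen X y -> ideal_gen X (x + y).
Proof.
move=> [s sX ->] [t tX ->]; exists (s ++ t); last by rewrite big_cat.
by move=> u; rewrite mem_cat => /orP[/sX|/tX].
Qed.

Lemma ideal_genMl X a x : ideal_gen X x -> ideal_gen X (a * x).
Proof.
move=> [s sX ->]; exists [seq (a * u.1, u.2) | u <- s].
  by move=> u /mapP[v /sX vX ->].
by rewrite big_map mulr_sumr; apply: eq_bigr => u _; rewrite mulrA.
Qed.

Lemma ideal_gen_base X x : X x -> ideal_gen X x.
Proof.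
move=> Xx; exists [:: (1, x)]; last by rewrite big_seq1 mul1r.
by move=> u; rewrite inE => /eqP ->.
Qed.

Lemma ideal_gen0 X : ideal_gen X 0.
Proof. by exists [::]; rewrite ?big_nil. Qed.

Lemma ideal_gen_sum X (I : eqType) (s : seq I) (F : I -> T) :
  (forall i, i \in s -> ideal_gen X (F i)) -> ideal_gen X (\sum_(i <- s) F i).
Proof.
move=> XF; rewrite big_seq.
by apply: (big_ind (ideal_gen X)) => //; [exact: ideal_gen0 | exact: ideal_genD].
Qed.

Lemma ideal_genZ X (c : K) x : ideal_gen X x -> ideal_gen X (c *: x).
Proof. by rewrite -mulr_algl; apply: ideal_genMl. Qed.

End IdealGen.

(** * Quotients by ideals spanned by classes of monomials *)

Section MonomialQuotients.

Variables (K : fieldType) (n : nat) (adj : rel 'I_n).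
Hypothesis adj_sym : ssrbool.symmetric adj.

Implicit Types (m : 'X_{1..n + n}) (f g : {mpoly K[n + n]}).
Implicit Types U V W : pred 'X_{1..n + n}.

Local Notation T := (binomial_edge_ring K adj).
Local Notation pr := (@edge_pi K n adj).

Lemma class_coefX_eq m m' : nform adj m' = nform adj m -> class_coef adj m 'X_[m'] = 1 :> K.
Proof. by rewrite class_coefX => /eqP ->. Qed.

Lemma class_coefX_neq m m' : nform adj m' != nform adj m -> class_coef adj m 'X_[m'] = 0 :> K.
Proof. by rewrite class_coefX => /negbTE ->. Qed.

Lemma class_coef_pr m f g : pr f = pr g -> class_coef adj m f = class_coef adj m g.
Proof.
move/pr_eqP/(class_coef_ideal adj_sym m); rewrite class_coefB => /eqP.
by rewrite subr_eq0 => /eqP.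
Qed.

Lemma nform_pr m m' : pr 'X_[m] = pr 'X_[m'] -> nform adj m = nform adj m'.
Proof.
move/(class_coef_pr m); rewrite (class_coefX_eq (erefl _)) => e.
apply/eqP; apply: contraT; rewrite eq_sym => /class_coefX_neq e0.
by move/eqP: e; rewrite e0 oner_eq0.
Qed.

(** Multiplying by [m0] can enlarge the support and merge components, so the proof passes through
    the ring, where equal classes have equal multiples. *)
Lemma nformDr m m' m0 : nform adj m = nform adj m' ->
  nform adj (m + m0) = nform adj (m' + m0)%MM.
Proof.
move/(pr_nform K adj_sym) => e; apply: nform_pr.
by rewrite !mpolyXD rmorphM /= e -rmorphM.
Qed.

Definition saturated U := forall m m', nform adj m = nform adj m' -> U m = U m'.
Definition upward U := forall m m', U m -> U (m + m')%MM.

(** Closed under addition for every [U]; an ideal once [U] is upward. *)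
Definition mon_ideal U : set T :=
  [set t | exists2 f, t = pr f & forall m, m \in msupp f -> U m].

Lemma mon_idealD U x y : mon_ideal U x -> mon_ideal U y -> mon_ideal U (x + y).
Proof.
move=> [f -> fU] [g -> gU]; exists (f + g); first by rewrite rmorphD.
by move=> m /msuppD_le; rewrite mem_cat => /orP[/fU|/gU].
Qed.

Lemma mon_ideal0 U : mon_ideal U 0.
Proof. by exists 0; rewrite ?rmorph0 // => m; rewrite msupp0. Qed.

Lemma mon_idealM U V W x y : (forall m m', U m -> V m' -> W (m + m')%MM) ->
  mon_ideal U x -> mon_ideal V y -> mon_ideal W (x * y).
Proof.
move=> UVW [f -> fU] [g -> gV]; exists (f * g); first by rewrite rmorphM.
by move=> m /msuppM_le/allpairsP[[m1 m2] /= [/fU m1U /gV m2V ->]]; apply: UVW.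
Qed.

Lemma mon_ideal_true x : mon_ideal predT x.
Proof. by exists (repr x); rewrite ?edge_pi_repr. Qed.

Lemma mon_idealX U m : U m -> mon_ideal U (pr 'X_[m]).
Proof. by move=> mU; exists 'X_[m] => // m'; rewrite msuppX inE => /eqP ->. Qed.

Lemma mon_ideal_gen U (X : set T) x : upward U ->
  (forall y, X y -> mon_ideal U y) -> ideal_gen X x -> mon_ideal U x.
Proof.
move=> upU XU [s sX ->]; rewrite big_seq.
apply: (big_ind (mon_ideal U)) => [|y z|u us].
- exact: mon_ideal0.
- exact: mon_idealD.
- apply: (@mon_idealM predT U U) (mon_ideal_true _) (XU _ (sX _ us)) => m m' _ m'U.
  by rewrite addmC; apply: upU.
Qed.

(** Saturation means that [U] is a union of whole classes, so no monomial of [U] shares the class of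
    [m]. *)
Lemma class_coef_mon_ideal U m f : saturated U -> ~~ U m ->
  mon_ideal U (pr f) -> class_coef adj m f = 0.
Proof.
move=> satU mU [g /(class_coef_pr m) -> gU].
rewrite class_coefE big_seq big1 // => m' m'g.
suff /negbTE -> : nform adj m' != nform adj m by rewrite mulr0.
by apply: contraNneq mU => /satU <-; apply: gU.
Qed.

Section Representatives.

Variables (U : pred 'X_{1..n + n}) (E : finType) (A : {set E}).
Variable (r : E -> 'X_{1..n + n}).
Hypothesis satU : saturated U.
Hypothesis r_notU : forall e, e \in A -> ~~ U (r e).
Hypothesis r_inj : {in A &, injective (fun e => nform adj (r e))}.
Hypothesis r_cover : forall m, ~~ U m -> exists2 e, e \in A & nform adj (r e) = nform adj m.

Lemma pr_normal_form f : (forall m, m \in msupp f -> ~~ U m) ->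
  pr f = \sum_(e in A) class_coef adj (r e) f *: pr 'X_[r e].
Proof.
move=> fU; rewrite {1}[f]mpolyE rmorph_sum /=.
under [RHS]eq_bigr => e _ do rewrite class_coefE scaler_suml.
rewrite exchange_big /= !big_seq; apply: eq_bigr => m /fU mU.
have [e eA em] := r_cover mU.
rewrite (bigD1 e eA) /= big1 => [|e' /andP[e'A ne]].
  rewrite em eqxx mulr1 addr0 linearZ /=.
  by rewrite (pr_nform K adj_sym em).
suff /negbTE -> : nform adj m != nform adj (r e') by rewrite mulr0 scale0r.
by apply: contra_neq ne => e'm; exact: (r_inj e'A eA (etrans (esym e'm) (esym em))).
Qed.

(** Spanning: the monomials of a polynomial that lie in [U] are dropped, and the others are replaced
    by their representatives. Independence: the coordinate functionals of the representatives vanish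
    on [mon_ideal U], which contains the ideal. *)
Lemma quotient_dim_classes (X : set T) : upward U ->
  (forall x, X x -> mon_ideal U x) ->
  (forall m, U m -> ideal_gen X (pr 'X_[m])) ->
  is_quotient_dim (ideal_gen X) #|A|.
Proof.
move=> upU XU UX; pose b (i : 'I_#|A|) := pr 'X_[r (enum_val i)].
exists b; split.
  move=> x; pose f := repr x.
  pose g := \sum_(m <- msupp f | ~~ U m) f@_m *: 'X_[m].
  have gU m : m \in msupp g -> ~~ U m.
    rewrite mcoeff_msupp; apply: contraNN => mU; rewrite raddf_sum /= big1 // => m' m'U.
    rewrite mcoeffZ mcoeffX; case: eqVneq => [e|]; last by rewrite mulr0.
    by rewrite e mU in m'U.
  exists (fun i => class_coef adj (r (enum_val i)) g).
  rewrite (_ : \sum_(i < _) _ = pr g); last first.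
    by rewrite (pr_normal_form gU) [RHS]big_enum_val.
  rewrite -[x]edge_pi_repr -/f {1}[f]mpolyE (bigID U) /= -/g -rmorphB addrK rmorph_sum /=.
  rewrite big_mkcond; apply: ideal_gen_sum => m _.
  case: ifP => [mU|_]; last exact: ideal_gen0.
  by rewrite linearZ /=; apply: ideal_genZ; apply: UX.
move=> c cI i.
have := mon_ideal_gen upU XU cI.
pose g := \sum_(j < #|A|) c j *: 'X_[r (enum_val j)].
have -> : \sum_(j < #|A|) c j *: b j = pr g.
  by rewrite rmorph_sum /=; apply: eq_bigr => j _; rewrite linearZ /=.
move/(class_coef_mon_ideal satU (r_notU (enum_valP i))).
rewrite class_coef_sum (bigD1 i erefl) /= big1 => [|j ji].
  by rewrite class_coefZ (class_coefX_eq (erefl _)) mulr1 addr0.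
rewrite class_coefZ class_coefX_neq; first by rewrite mulr0.
apply: contra_neq ji => e; apply: enum_val_inj.
by exact: (r_inj (enum_valP j) (enum_valP i) e).
Qed.

End Representatives.

End MonomialQuotients.

(** * Lengths modulo powers and Frobenius powers of the maximal ideal *)

Section MaximalIdealPowers.

Variables (K : fieldType) (n : nat) (adj : rel 'I_n).
Hypothesis adj_sym : ssrbool.symmetric adj.

Implicit Types (m : 'X_{1..n + n}) (f g : {mpoly K[n + n]}).

Local Notation T := (binomial_edge_ring K adj).
Local Notation pr := (@edge_pi K n adj).
Local Notation mx := (@binomial_edge_max K n adj).

Definition deg_ge r m := (r <= mdeg m)%N.

Lemma deg_ge_saturated r : saturated adj (deg_ge r).
Proof.
by move=> m m' e; rewrite /deg_ge !mdeg_split (eq_bigr _ (fun i _ => nform_vdeg e i)).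
Qed.

Lemma deg_ge_upward r : upward (deg_ge r : pred 'X_{1..n + n}).
Proof. by move=> m m' le_rm; rewrite /deg_ge mdegD; apply: leq_trans le_rm (leq_addr _ _). Qed.

Lemma edge_max_gen x : mx x -> mon_ideal (deg_ge 1) x.
Proof.
apply: mon_ideal_gen; first exact: deg_ge_upward.
move=> y [k _ <-]; apply: mon_idealX.
by rewrite /deg_ge mdeg1.
Qed.

Lemma prod_edge_max r (g : 'I_r -> T) : (forall i, mx (g i)) ->
  mon_ideal (deg_ge r) (\prod_(i < r) g i).
Proof.
elim: r g => [|r IHr] g gm.
  by have [f -> _] := @mon_ideal_true K n adj (\prod_(i < 0) g i); exists f.
rewrite big_ord_recr /=; apply: (@mon_idealM _ _ _ (deg_ge r) (deg_ge 1)).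
- by move=> m m'; rewrite /deg_ge mdegD -(addn1 r); apply: leq_add.
- by apply: IHr => i; apply: gm.
- by apply: edge_max_gen; apply: gm.
Qed.

Lemma edge_max_var k : mx (pr 'X_k).
Proof. by apply: ideal_gen_base; exists k. Qed.

Lemma expn_edge_max_mon r m : deg_ge r m -> ideal_expn mx r (pr 'X_[m]).
Proof.
(* Variables are split off one at a time. The factors are indexed by all of [nat], so that the
   induction only has to redefine the one at position r. *)
move=> rm; suff [g gm [m' ->]] : exists2 g : nat -> T, forall i, mx (g i) &
    exists m', pr 'X_[m] = pr 'X_[m'] * \prod_(i < r) g i.
  by apply: ideal_genMl; apply: ideal_gen_base; exists (fun i : 'I_r => g i).
elim: r m rm => [|r IHr] m rm.
  exists (fun=> 0); first by move=> i; apply: ideal_gen0.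
  by exists m; rewrite big_ord0 mulr1.
have /existsP[k mk] : [exists k, m k != 0%N].
  rewrite -negb_forall; apply: contraTN rm => /forallP m0.
  by rewrite /deg_ge mdegE big1 // => k _; apply/eqP; apply: m0.
have /IHr[g gm [m' e]] : deg_ge r (m - U_(k))%MM.
  have : mdeg m = (mdeg (m - U_(k))%MM + 1)%N.
    by rewrite -(mdeg1 k) -mdegD submK // lep1mP.
  by move: rm; rewrite /deg_ge => + md; rewrite md addn1.
exists (fun i => if i == r then pr 'X_k else g i).
  by move=> i; case: ifP => _; [exact: edge_max_var | exact: gm].
exists m'; rewrite big_ord_recr /= eqxx mulrA.
have -> : \prod_(i < r) (if val i == r then pr 'X_k else g i) = \prod_(i < r) g i.
  by apply: eq_bigr => i _; rewrite (ltn_eqF (ltn_ord i)).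
by rewrite -e -rmorphM -mpolyXD submK // lep1mP.
Qed.

Lemma expn_edge_max_dim r (E : finType) (A : {set E}) (c : E -> 'X_{1..n + n}) :
  (forall e, e \in A -> mdeg (c e) < r)%N ->
  {in A &, injective (fun e => nform adj (c e))} ->
  (forall m, mdeg m < r -> exists2 e, e \in A & nform adj (c e) = nform adj m)%N ->
  is_quotient_dim (ideal_expn mx r) #|A|.
Proof.
move=> cr c_inj c_cov; apply: (quotient_dim_classes adj_sym (@deg_ge_saturated r) _ c_inj).
- by move=> e /cr; rewrite /deg_ge -ltnNge.
- by move=> m; rewrite /deg_ge -ltnNge => /c_cov.
- exact: deg_ge_upward.
- by move=> x [g gm ->]; apply: prod_edge_max.
- exact: expn_edge_max_mon.
Qed.

(* A class of monomials lies in the Frobenius power as soon as one of its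
   members is divisible by the q-th power of a variable. *)
Definition pow_div q m : bool :=
  `[< exists2 m', nform adj m' = nform adj m & exists k, (q <= m' k)%N >].

Lemma pow_div_saturated q : saturated adj (pow_div q).
Proof. by move=> m m' e; rewrite /pow_div e. Qed.

Lemma pow_div_upward q : upward (pow_div q).
Proof.
move=> m m0 /asboolP[m' e [k qk]]; apply/asboolP; exists (m' + m0)%MM.
  exact (nformDr K adj_sym m0 e).
by exists k; rewrite mnmDE; exact: leq_trans qk (leq_addr _ _).
Qed.

Lemma frobenius_edge_max_mon q m : pow_div q m ->
  frobenius_power mx q (pr 'X_[m]).
Proof.
move=> /asboolP[m' e [k qk]]; rewrite -(pr_nform K adj_sym e).
have -> : m' = (m' - U_(k) *+ q + U_(k) *+ q)%MM.
  apply/mnmP => j; rewrite mnmDE mnmBE mulmnE mnm1E.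
  by case: eqVneq => [<-|_]; rewrite ?mul1n ?mul0n ?subnK ?addn0 ?subn0.
rewrite mpolyXD -mpolyXn rmorphM rmorphXn /=; apply: ideal_genMl.
by apply: ideal_gen_base; exists (pr 'X_k); [exact: edge_max_var | reflexivity].
Qed.

(** In characteristic p the p^k-th power map is additive, so a combination of variables is sent to a
    combination of p^k-th powers of variables. *)
Lemma frobenius_edge_max_gen p k x : p \in [pchar K] -> mx x ->
  mon_ideal (pow_div (p ^ k)) (x ^+ (p ^ k)).
Proof.
move=> pK [s sX ->]; have pT : p \in [pchar T] by rewrite pchar_lalg.
have pr_p := pcharf_prime pK.
have qT : [pchar T].-nat (p ^ k)%N by rewrite (eq_pnat _ (pcharf_eq pT)) pnatX pnat_id.
have q0 : (p ^ k == 0)%N = false by apply/negbTE; rewrite -lt0n expn_gt0 prime_gt0.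
rewrite big_seq; elim/big_rec: _ => [|u y us yI].
  by rewrite expr0n q0; apply: mon_ideal0.
rewrite exprDn_pchar //.
apply: mon_idealD yI; rewrite exprMn.
apply: (@mon_idealM _ _ _ predT (pow_div (p ^ k))) (mon_ideal_true _) _.
  by move=> m m' _ m'U; rewrite addmC; apply: pow_div_upward.
have [j _ <-] := sX _ us; rewrite -[X in X ^+ _]/(pr 'X_j) -rmorphXn mpolyXn.
apply: mon_idealX; apply/asboolP; exists (U_(j) *+ p ^ k)%MM => //; exists j.
by rewrite mulmnE mnm1E eqxx mul1n.
Qed.

Lemma frobenius_edge_max_dim p k (E : finType) (A : {set E}) (c : E -> 'X_{1..n + n}) :
  p \in [pchar K] ->
  (forall e, e \in A -> ~~ pow_div (p ^ k) (c e)) ->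
  {in A &, injective (fun e => nform adj (c e))} ->
  (forall m, ~~ pow_div (p ^ k) m ->
     exists2 e, e \in A & nform adj (c e) = nform adj m) ->
  is_quotient_dim (frobenius_power mx (p ^ k)) #|A|.
Proof.
move=> pK cN c_inj c_cov.
apply: (quotient_dim_classes adj_sym (@pow_div_saturated (p ^ k)) cN c_inj c_cov).
- exact: pow_div_upward.
- by move=> x [y ym <-]; apply: frobenius_edge_max_gen.
- exact: frobenius_edge_max_mon.
Qed.

End MaximalIdealPowers.

(** * Connected components indexed by their representative vertices *)

Section Components.

Variables (n : nat) (adj : rel 'I_n).
Hypothesis adj_sym : ssrbool.symmetric adj.
Implicit Types S : {set 'I_n}.

Definition reps S : {set 'I_n} := [set i | (i \notin S) && (rep adj S i == i)]%SET.
Definition comp_of S i : {set 'I_n} := [set j | rep adj S j == i]%SET.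

Lemma rep_rep S i : rep adj S (rep adj S i) = rep adj S i.
Proof. exact: (root_root (adj_minus_sym adj_sym S)). Qed.

Lemma rep_in_reps S i : (rep adj S i \in reps S) = (i \notin S).
Proof. by rewrite inE (rep_notin adj_sym) rep_rep eqxx andbT. Qed.

Lemma components_reps S : components adj S = [set comp_of S i | i in reps S]%SET.
Proof.
have compE i : i \notin S ->
    [set j in ~: S | connect (adj_minus adj S) i j]%SET = comp_of S (rep adj S i).
  move=> iS; apply/setP => j; rewrite !inE; apply/andP/eqP => [[_ /(repP adj_sym) ->//]|e].
  by split; [rewrite -(rep_notin adj_sym) e (rep_notin adj_sym) | apply/(repP adj_sym)].
apply/setP => B; apply/imsetP/imsetP => -[i]; rewrite !inE.
  by move=> iS ->; exists (rep adj S i); rewrite ?rep_in_reps // compE.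
case/andP=> iS /eqP ri ->; exists i; rewrite ?inE //.
by rewrite compE // ri.
Qed.

Lemma comp_of_inj S : {in reps S &, injective (comp_of S)}.
Proof.
move=> i j; rewrite !inE => /andP[_ /eqP ri] /andP[_ _] /setP/(_ i).
by rewrite !inE ri eqxx => /esym/eqP.
Qed.

Lemma big_components (R : Type) (idx : R) (op : Monoid.com_law idx)
    (F : {set 'I_n} -> R) S :
  \big[op/idx]_(B in components adj S) F B =
  \big[op/idx]_(i in reps S) F (comp_of S i).
Proof. by rewrite components_reps big_imset //; apply: comp_of_inj. Qed.

Lemma card_components S : #|components adj S| = #|reps S|.
Proof. by rewrite components_reps card_in_imset //; apply: comp_of_inj. Qed.

Lemma comp_of_notin S i j : i \in reps S -> j \in comp_of S i -> j \notin S.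
Proof.
by rewrite !inE => /andP[iS _] /eqP e; rewrite -(rep_notin adj_sym) e.
Qed.

Lemma sum_comp_of S (F : 'I_n -> nat) :
  (\sum_(i in reps S) \sum_(j in comp_of S i) F j = \sum_(j | j \notin S) F j)%N.
Proof.
rewrite [RHS](partition_big (rep adj S) (fun i => i \in reps S)) /=; last first.
  by move=> j; rewrite rep_in_reps.
apply: eq_bigr => i iS; apply: eq_bigl => j; rewrite inE.
apply/idP/andP => [ji|[_ ji] //]; split=> //.
by apply: (comp_of_notin iS); rewrite inE.
Qed.

End Components.

(** * Lower bound for the Krull dimension: a chain of kernels *)

Definition prime_ideal_of (R : comNzRingType) (P : R -> bool)
    (P_ideal : idealr_closed P) (P_prime : prime_idealr_closed P) : prime_idealr R :=
  HB.pack P (isIdealr.Build R P P_ideal) (isPrimeIdealrClosed.Build R P P_prime).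

Section KrullLowerBound.

Variables (K : fieldType) (n : nat) (adj : rel 'I_n).
Hypothesis adj_sym : ssrbool.symmetric adj.
Implicit Types (S : {set 'I_n}) (D : {set 'I_(n + n)}) (f : {mpoly K[n + n]}).

Local Notation T := (binomial_edge_ring K adj).
Local Notation pr := (@edge_pi K n adj).

Lemma mpolyX_neq0 (m : 'X_{1..n + n}) : 'X_[m] != 0 :> {mpoly K[n + n]}.
Proof.
apply/eqP => /(congr1 (mcoeff m)); rewrite mcoeffX eqxx mcoeff0.
by move/eqP; rewrite oner_eq0.
Qed.

(** Killing more variables factors through killing fewer, which is why the kernels are nested. *)
Lemma edge_sub_kill S D D' f : D \subset D' ->
  edge_sub adj S D' f = mmap (@mpolyC (n + n) K) (kill K D') (edge_sub adj S D f).
Proof.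
move=> /fintype.subsetP sDD'.
have killE k : mmap (@mpolyC (n + n) K) (kill K D') (kill K D k) = kill K D' k.
  rewrite /kill; case: ifP => [/sDD' ->|_]; first exact: mmap0.
  by rewrite mmapX mmap1U.
rewrite [f]mpolyE [LHS](raddf_sum (edge_sub adj S D')).
rewrite (raddf_sum (edge_sub adj S D)) (raddf_sum (mmap _ _)) /=.
apply: eq_bigr => m _; rewrite !edge_subZ mmapZ mul_mpolyC !edge_subX; congr (_ *: _).
by rewrite rmorphM !rmorph_prod /=; congr (_ * _); apply: eq_bigr => i _;
  rewrite rmorphXn /= killE.
Qed.

Section Prime.

Variables (S : {set 'I_n}) (D : {set 'I_(n + n)}).
Hypothesis SD : forall i, i \in S -> lshift n i \in D.

(** The kernel of the parametrization, read on a chosen representative; independence of the choice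
    is [edge_prime_pi], and primality comes from the target being a domain. *)
Definition edge_prime (x : T) : bool := edge_sub adj S D (repr x) == 0.

Lemma edge_prime_pi f : edge_prime (pr f) = (edge_sub adj S D f == 0).
Proof.
rewrite /edge_prime; suff -> : edge_sub adj S D (repr (pr f)) = edge_sub adj S D f by [].
apply/eqP; rewrite -subr_eq0 -rmorphB; apply/eqP.
by apply: (edge_sub_ideal adj_sym SD); apply/pr_eqP; rewrite edge_pi_repr.
Qed.

Lemma edge_prime_ideal : idealr_closed edge_prime.
Proof.
split.
- rewrite -[0](rmorph0 pr) -topredE /= edge_prime_pi rmorph0; exact: eqxx.
- by rewrite -[1](rmorph1 pr) -topredE /= edge_prime_pi rmorph1 oner_eq0.
move=> a x y; rewrite -[a]edge_pi_repr -[x]edge_pi_repr -[y]edge_pi_repr.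
rewrite -rmorphM -rmorphD -!topredE /= !edge_prime_pi rmorphD rmorphM /=.
by move=> /eqP -> /eqP ->; rewrite mulr0 addr0.
Qed.

Lemma edge_prime_prime : prime_idealr_closed edge_prime.
Proof.
move=> x y; rewrite -[x]edge_pi_repr -[y]edge_pi_repr -rmorphM -!topredE /=.
by rewrite !edge_prime_pi rmorphM mulf_eq0.
Qed.

Definition edge_prime_idealr : prime_idealr T :=
  prime_ideal_of edge_prime_ideal edge_prime_prime.

Lemma mem_edge_prime f : (pr f \in edge_prime_idealr) = (edge_sub adj S D f == 0).
Proof. exact: edge_prime_pi. Qed.

End Prime.

Lemma edge_prime_sub S D D' (SD : forall i, i \in S -> lshift n i \in D)
    (SD' : forall i, i \in S -> lshift n i \in D') : D \subset D' ->
  {subset edge_prime_idealr SD <= edge_prime_idealr SD'}.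
Proof.
move=> sDD x; rewrite -[x]edge_pi_repr !mem_edge_prime => /eqP e.
by rewrite (edge_sub_kill _ _ sDD) e mmap0; exact: eqxx.
Qed.

(** One more variable is killed at each step. Strictness between steps i and j is witnessed by the
    i-th killed variable: [y_r], with image [s_r u_r], if it is [u_r], and [x_r] if it is [s_r]. *)
Lemma has_prime_chain_components S :
  has_prime_chain T (#|~: S| + #|components adj S|).
Proof.
rewrite (card_components adj_sym) addnC.
pose ys := [seq rshift n i | i <- enum (reps adj S)].
pose xs := [seq lshift n i | i <- enum (~: S)].
have sys : size ys = #|reps adj S| by rewrite size_map -cardE.
have sxs : size xs = #|~: S| by rewrite size_map -cardE.
have s_uniq : uniq (ys ++ xs).
  rewrite cat_uniq !map_inj_uniq ?enum_uniq //=; last exact: rshift_inj; last exact: lshift_inj.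
  rewrite andbT; apply/hasPn => v /mapP[i _ ->]; apply/mapP => -[j _ /eqP].
  by rewrite eq_lrshift.
pose D k := ([set lshift n i | i in S] :|: [set v in take k (ys ++ xs)])%SET.
have SD k i : i \in S -> lshift n i \in D k by move=> iS; rewrite inE imset_f.
have takeP v v0 (i j : nat) : (i < #|reps adj S| + #|~: S|)%N ->
    v = nth v0 (ys ++ xs) i -> (v \in take j (ys ++ xs)) = (i < j)%N.
  by rewrite -sys -sxs -size_cat => lti ->; rewrite in_take ?mem_nth // index_uniq.
have kill_eq0 k v : v \in take k (ys ++ xs) -> kill K (D k) v = 0.
  by move=> vk; rewrite /kill !inE vk orbT.
(* The variables u_c are killed before the s_i, so that y_r is still a witness
   when the variable of the representative r is killed. *)
exists (fun k : 'I_(_).+1 => edge_prime_idealr (SD k)) => i j ij.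
have lti : (i < #|reps adj S| + #|~: S|)%N.
  by rewrite -ltnS; apply: leq_trans (ltn_ord j); rewrite ltnS.
split.
  apply: edge_prime_sub; apply/finset.setUS/fintype.subsetP => v.
  by rewrite !inE -(subnKC (ltnW ij)) takeD mem_cat => ->.
move=> sub; have subE f : edge_sub adj S (D j) f = 0 -> edge_sub adj S (D i) f = 0.
  by move=> e; have := sub (pr f); rewrite !mem_edge_prime e eqxx => /(_ isT)/eqP.
have [iys|iys] := ltnP i #|reps adj S|.
  have /card_gt0P[r0 _] : (0 < #|reps adj S|)%N by apply: leq_ltn_trans iys.
  pose r := nth r0 (enum (reps adj S)) i.
  have rS : r \in reps adj S by rewrite -mem_enum mem_nth // -cardE.
  have rE : rshift n r = nth (rshift n r0) (ys ++ xs) i.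
    by rewrite nth_cat sys iys (nth_map r0) // -cardE.
  move: (rS); rewrite inE => /andP[rNS /eqP rr].
  have := subE (yvar K r); rewrite !edge_sub_yvar rr.
  rewrite (kill_eq0 j (rshift n r)) ?(takeP _ _ _ _ lti rE) // mulr0 => /(_ erefl)/eqP.
  rewrite /kill !inE (takeP _ _ _ _ lti rE) ltnn orbF.
  rewrite (mem_imset _ _ (@lshift_inj n n)) (negbTE rNS) /=.
  rewrite take_cat sys iys ifN; last first.
    apply/negP => /mem_take/mapP[k _ /eqP]; by rewrite eq_lrshift.
  rewrite ifN; last by apply/imsetP => -[k _ /eqP]; rewrite eq_rlshift.
  by rewrite mulf_eq0 !(negbTE (mpolyX_neq0 _)).
have lti' : (i - #|reps adj S| < #|~: S|)%N by rewrite ltn_subLR.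
have /card_gt0P[r0 _] : (0 < #|~: S|)%N by apply: leq_ltn_trans lti'.
pose r := nth r0 (enum (~: S)) (i - #|reps adj S|)%N.
have rS : r \notin S by rewrite -finset.in_setC -mem_enum mem_nth // -cardE.
have rE : lshift n r = nth (lshift n r0) (ys ++ xs) i.
  by rewrite nth_cat sys ltnNge iys /= (nth_map r0) // -cardE.
have := subE (xvar K r); rewrite !edge_sub_xvar.
rewrite (kill_eq0 j) ?(takeP _ _ _ _ lti rE) // => /(_ erefl)/eqP.
rewrite /kill !inE (takeP _ _ _ _ lti rE) ltnn orbF.
by rewrite (mem_imset _ _ (@lshift_inj n n)) (negbTE rS) (negbTE (mpolyX_neq0 _)).
Qed.

End KrullLowerBound.

(** * Upper bound for the Krull dimension from the growth of lengths *)

Section KrullUpperBound.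

Variables (K : fieldType) (n : nat) (adj : rel 'I_n).
Hypothesis adj_sym : ssrbool.symmetric adj.
Implicit Types (f : {mpoly K[n + n]}).

Local Notation T := (binomial_edge_ring K adj).
Local Notation pr := (@edge_pi K n adj).

Definition deg_le N f := forall m, m \in msupp f -> (mdeg m <= N)%N.

Lemma deg_leM N N' f f' : deg_le N f -> deg_le N' f' -> deg_le (N + N') (f * f').
Proof.
move=> fN f'N m /msuppM_le/allpairsP[[m1 m2] /= [/fN m1N /f'N m2N ->]].
by rewrite mdegD leq_add.
Qed.

Lemma deg_le1 : deg_le 0 1.
Proof. by move=> m; rewrite msupp1 inE => /eqP ->; rewrite mdeg0. Qed.

Lemma deg_leX N f k : deg_le N f -> deg_le (k * N) (f ^+ k).
Proof.
move=> fN; elim: k => [|k IHk]; first by rewrite expr0 mul0n; apply: deg_le1.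
by rewrite exprS mulSn; apply: deg_leM.
Qed.

Lemma deg_leW N N' f : (N <= N')%N -> deg_le N f -> deg_le N' f.
Proof. by move=> NN' fN m /fN /leq_trans; apply. Qed.

Lemma deg_le_sum N (I : finType) (F : I -> {mpoly K[n + n]}) (a : I -> K) :
  (forall i, deg_le N (F i)) -> deg_le N (\sum_i a i *: F i).
Proof.
move=> FN m /msupp_sum_le; rewrite filter_predT.
move=> /flattenP[s /mapP[i _ ->]] /msuppZ_le; exact: FN.
Qed.

Definition independent_mod (P : T -> Prop) (I : finType) (g : I -> {mpoly K[n + n]}) :=
  forall a : I -> K, P (pr (\sum_i a i *: g i)) -> forall i, a i = 0.

(** Modulo the ideal, polynomials of degree at most r are determined by their coordinates on [A]. A
    family larger than [A] has a coordinate matrix with nonzero left kernel, which gives a linear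
    relation. *)
Lemma independent_card_le r (E : finType) (A : {set E}) (c : E -> 'X_{1..n + n})
    (I : finType) (g : I -> {mpoly K[n + n]}) :
  {in A &, injective (fun e => nform adj (c e))} ->
  (forall m, mdeg m < r.+1 -> exists2 e, e \in A & nform adj (c e) = nform adj m)%N ->
  (forall i, deg_le r (g i)) -> independent_mod (fun x => x = 0) g ->
  (#|I| <= #|A|)%N.
Proof.
move=> c_inj c_cov gr g_indep; rewrite leqNgt; apply/negP => ltAI.
pose M : 'M[K]_(#|I|, #|A|) :=
  \matrix_(i, j) class_coef adj (c (enum_val j)) (g (enum_val i)).
have : kermx M != 0.
  by rewrite kermx_eq0 /row_free neq_ltn (leq_ltn_trans (rank_leq_col _)).
case/rowV0Pn => v /sub_kermxP vM.
suff -> : v = 0 by rewrite eqxx.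
pose a i := v 0 (enum_rank i).
have a0 : forall i, a i = 0.
  apply: g_indep; pose U : pred 'X_{1..n + n} := deg_ge r.+1.
  have c_cov' m : ~~ U m -> exists2 e, e \in A & nform adj (c e) = nform adj m.
    by rewrite /U /deg_ge -ltnNge; apply: c_cov.
  rewrite (pr_normal_form adj_sym c_inj c_cov'); last first.
    by move=> m /(deg_le_sum gr); rewrite /U /deg_ge -ltnNge.
  rewrite big1 // => e eA.
  suff -> : class_coef adj (c e) (\sum_i a i *: g i) = 0 by rewrite scale0r.
  rewrite class_coef_sum; have := congr1 (fun u : 'rV_#|A| => u 0 (enum_rank_in eA e)) vM.
  rewrite mxE [RHS]mxE => e0; rewrite -[RHS]e0 [RHS](reindex enum_rank) /=; last first.
    by apply: onW_bij; apply: enum_rank_bij.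
  by apply: eq_bigr => i _; rewrite class_coefZ mxE enum_rankK_in // enum_rankK.
apply/rowP => j; rewrite mxE -[j]enum_valK; exact: a0.
Qed.

(** Modulo [Q] only the terms with exponent 0 of [f] remain, so their coefficients vanish. What is
    left is a multiple of [f], which is cancelled because [P] is prime and does not contain the
    class of [f]. *)
Lemma independent_step (P Q : prime_idealr T) f (I : finType)
    (g : I -> {mpoly K[n + n]}) k :
  {subset P <= Q} -> pr f \in Q -> pr f \notin P ->
  independent_mod (fun x => x \in Q) g ->
  independent_mod (fun x => x \in P) (fun u : 'I_k * I => f ^+ u.1 * g u.2).
Proof.
move=> sPQ fQ fP g_indep a.
have -> : \sum_u a u *: (f ^+ u.1 * g u.2) =
    \sum_(j < k) \sum_i a (j, i) *: (f ^+ j * g i).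
  by rewrite pair_bigA; apply: eq_bigr => -[j i].
(* Coefficients indexed by all of [nat] allow the shift [b j.+1] in the induction. *)
suff ind (b : nat -> I -> K) : pr (\sum_(j < k) f ^+ j * \sum_i b j i *: g i) \in P ->
    forall j i, (j < k)%N -> b j i = 0.
  move=> aP [j i].
  (* The coefficients are extended by 0 beyond the range of ['I_k]. *)
  pose b (j' : nat) i' := if insub j' is Some j'' then a (j'', i') else 0.
  have bE (j' : 'I_k) i' : b j' i' = a (j', i') by rewrite /b valK.
  rewrite -bE; apply: ind (ltn_ord j).
  rewrite (_ : \sum_(j < k) _ = \sum_(j < k) \sum_i a (j, i) *: (f ^+ j * g i)) //.
  apply: eq_bigr => j' _; rewrite mulr_sumr; apply: eq_bigr => i' _.
  by rewrite bE -scalerAr.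
elim: k b {a} => // k IHk b; rewrite big_ord_recl expr0 mul1r.
set h0 := \sum_i _; set h1 := \sum_(j < k) _ => hP.
pose h2 := \sum_(j < k) f ^+ j * \sum_i b j.+1 i *: g i.
have h1E : h1 = f * h2.
  by rewrite mulr_sumr; apply: eq_bigr => j _; rewrite exprS mulrA.
have b0 : forall i, b 0%N i = 0.
  apply: g_indep; rewrite -/h0.
  have := sPQ _ hP; rewrite rmorphD h1E rmorphM /= => hQ.
  rewrite -[pr h0](addrK (pr f * pr h2)) rpredB //.
  by rewrite prime_idealrM fQ.
have h00 : h0 = 0 by rewrite /h0 big1 // => i _; rewrite b0 scale0r.
move: hP; rewrite h00 add0r h1E rmorphM /= prime_idealrM (negbTE fP) /= => h2P.
by case=> [|j] i ij; [exact: b0 | exact: (IHk (fun j => b j.+1))].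
Qed.

(** Induction down from the top of the chain, starting with the family [1], independent modulo a
    proper ideal. Each step multiplies by the powers up to k of one new element; the slope [s] of
    the degree bound does not depend on k. *)
Lemma chain_independent d (P : 'I_d.+1 -> prime_idealr T) e : (e <= d)%N ->
  (forall i j : 'I_d.+1, (i < j)%N -> {subset P i <= P j} /\ ~ {subset P j <= P i}) ->
  exists s, forall k, exists (I : finType) (g : I -> {mpoly K[n + n]}),
    [/\ #|I| = (k.+1 ^ e)%N, forall i, deg_le (k * s) (g i) &
        independent_mod (fun x => x \in P (inord (d - e))) g].
Proof.
move=> led chain; elim: e led => [_|e IHe led].
  exists 0%N => k; exists unit, (fun=> 1); split.
  - by rewrite card_unit.
  - by move=> _; rewrite muln0; apply: deg_le1.
  move=> a; rewrite (bigD1 tt) //= big1 => [|[]//].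
  rewrite addr0 linearZ /= rmorph1 => aP [].
  apply/eqP; apply: contraT => a0.
  have := idealr1 (P (inord (d - 0))).
  suff -> : (1 : T) \in P (inord (d - 0)) by [].
  have -> : (1 : T) = (a tt)^-1%:A * (a tt *: 1).
    by rewrite -scalerAr mulr1 scalerA divff // scale1r.
  exact: idealMr.
have [s IHs] := IHe (ltnW led).
have [sub nsub] : {subset P (inord (d - e.+1)) <= P (inord (d - e))} /\
    ~ {subset P (inord (d - e)) <= P (inord (d - e.+1))}.
  by apply: chain; rewrite !inordK ?ltnS ?leq_subr // -subSn // subSS.
have [f fQ fP] : exists2 f, pr f \in P (inord (d - e)) & pr f \notin P (inord (d - e.+1)).
  apply/not_exists2P => no; apply: nsub => x; rewrite -[x]edge_pi_repr => xQ.
  by case: (no (repr x)) => // /negP; rewrite negbK.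
exists (msize f + s)%N => k; have [I [g [cI gk g_indep]]] := IHs k.
exists ('I_k.+1 * I)%type, (fun u : 'I_k.+1 * I => f ^+ u.1 * g u.2); split.
- by rewrite card_prod card_ord cI expnS.
- move=> [j i] /=; rewrite mulnDr; apply: deg_leM (gk i).
  apply: (@deg_leW (j * msize f)); first by rewrite leq_mul2r -ltnS ltn_ord orbT.
  by apply: deg_leX => m /msize_mdeg_lt/ltnW.
- exact: (independent_step sub fQ fP g_indep).
Qed.

(** A chain of length d' yields (k + 1)^d' independent elements of degree at most k s, hence (k +
    1)^d' is at most C (k s + 1)^d for every k. *)
Lemma krull_upper_bound d C (l : nat -> nat) :
  (forall r, exists (E : finType) (A : {set E}) (c : E -> 'X_{1..n + n}),
    [/\ {in A &, injective (fun e => nform adj (c e))},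
        forall m, (mdeg m < r)%N -> exists2 e, e \in A & nform adj (c e) = nform adj m &
        #|A| = l r]) ->
  (forall r, l r.+1 <= C * r.+1 ^ d)%N ->
  forall d', has_prime_chain T d' -> (d' <= d)%N.
Proof.
move=> reps lC d' [P chain]; rewrite leqNgt; apply/negP => ltd.
have [s Hs] := chain_independent (leqnn d') chain.
(* Taking k = M is enough: C (M s + 1)^d is at most C ((M + 1) (s + 1))^d = M (M + 1)^d, which is
   less than (M + 1)^(d + 1). *)
pose M := (C * s.+1 ^ d)%N.
have [I [g [cI gk g_indep]]] := Hs M.
have [E [A [c [c_inj c_cov cA]]]] := reps (M * s).+1.
have := independent_card_le c_inj c_cov gk.
have g0 : independent_mod (fun x => x = 0) g.
  by move=> a e; apply: g_indep; rewrite e rpred0.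
move=> /(_ g0); rewrite cI cA => /leq_trans/(_ (lC _)).
apply/negP; rewrite -ltnNge.
have h1 : ((M * s).+1 ^ d <= (M.+1 * s.+1) ^ d)%N.
  by case: (posnP d) => [->|d0]; rewrite ?expn0 // leq_exp2r // mulSn mulnS; lia.
apply: (@leq_ltn_trans (M * M.+1 ^ d)).
  have -> : (M * M.+1 ^ d = C * (M.+1 * s.+1) ^ d)%N.
    by rewrite {1}/M expnMn -mulnA (mulnC (s.+1 ^ d)%N).
  by rewrite leq_mul2l h1 orbT.
apply: (@leq_trans (M.+1 ^ d.+1)); first by rewrite expnS ltn_mul2r expn_gt0 /= ltnSn.
by rewrite leq_pexp2l.
Qed.

End KrullUpperBound.

(** * Monomial classes as pairs of bounded degree functions *)

Definition nat_ffun (I : finType) N (a : {ffun I -> 'I_N}) (i : I) : nat := a i.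

Section ClassFamilies.

Variables (n : nat) (adj : rel 'I_n).
Hypothesis adj_sym : ssrbool.symmetric adj.
Implicit Types (m : 'X_{1..n + n}) (S C : {set 'I_n}) (a b k : 'I_n -> nat).

(** Starting from [b], one entry in [C] below its bound is raised by 1 until the sum reaches [t]. *)
Lemma fill_between C a b t : (forall i, b i <= a i)%N ->
  (\sum_(i in C) b i <= t <= \sum_(i in C) a i)%N ->
  exists2 b', (forall i, b i <= b' i <= a i)%N & (\sum_(i in C) b' i = t)%N.
Proof.
move=> le_ba /andP[le_bt le_ta].
have [d] : exists d, t = (\sum_(i in C) b i + d)%N.
  by exists (t - \sum_(i in C) b i)%N; rewrite subnKC.
elim: d b le_ba {le_bt} => [|d IHd] b le_ba tE.
  by exists b; [move=> i; rewrite leqnn /= | rewrite tE addn0].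
have [/existsP[i /andP[iC bi]]|/existsPn no] :=
    boolP [exists i, (i \in C) && (b i < a i)%N]; last first.
  have : (\sum_(i in C) a i <= \sum_(i in C) b i)%N.
    by apply: leq_sum => i iC; move: (no i); rewrite iC /= -leqNgt.
  move: le_ta; rewrite tE; lia.
pose b1 x := (b x + (x == i))%N.
have le_b1a x : (b1 x <= a x)%N.
  by rewrite /b1; case: eqVneq => [->|_]; rewrite ?addn1 ?addn0.
have [b' b'P b't] : exists2 b', (forall i, b1 i <= b' i <= a i)%N &
    (\sum_(i in C) b' i = t)%N.
  apply: IHd => //; rewrite tE -addSnnS; congr (_ + _)%N.
  rewrite [in LHS](bigD1 i) //= [in RHS](bigD1 i) //= /b1 eqxx addn1 addSn.
  by congr (_ + _).+1; apply: eq_bigr => x /andP[_ /negbTE ->]; rewrite addn0.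
exists b' => // x; case/andP: (b'P x) => h ->; rewrite andbT.
by apply: leq_trans h; apply: leq_addr.
Qed.

Definition fzero a : {set 'I_n} := [set i | a i == 0%N]%SET.
Definition ysum m j := nform adj m (rshift n j).

Definition comp_deg a j := (\sum_(i in comp_of adj (fzero a) j) a i)%N.

(* The pairs (a, k) that occur as vertex degrees and y-degrees of components of
   a monomial. *)
Definition class_valid a k := [forall j,
  if j \in reps adj (fzero a) then (k j <= comp_deg a j)%N else k j == 0%N].

Lemma ysumE m j :
  ysum m j = (\sum_(i in comp_of adj (vzero m) j) m (rshift n i))%N.
Proof. by rewrite /ysum nform_aty; apply: eq_bigl => i; rewrite inE. Qed.

Lemma nform_ysum m m' : vdeg m =1 vdeg m' -> ysum m =1 ysum m' ->
  nform adj m = nform adj m'.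
Proof.
move=> ed ey; apply: eq_mnm_split => i; last exact: (ey i).
transitivity (vdeg m i); first exact: nform_atx.
by rewrite ed; apply/esym; exact: nform_atx.
Qed.

Lemma class_valid_mon m : class_valid (vdeg m) (ysum m).
Proof.
apply/forallP => j; rewrite ysumE -[vzero m]/(fzero (vdeg m)).
case: ifPn => jS; first by apply: leq_sum => i _; apply: leq_addl.
(* If [j] is not a representative, a vertex represented by [j] lies in the zero set, where the
   y-exponent is 0. *)
rewrite big1 // => i; rewrite inE => /eqP ij.
apply/eqP; rewrite -leqn0; move: jS; rewrite -ij (rep_in_reps adj_sym) negbK inE.
by move=> /eqP <-; apply: leq_addl.
Qed.

(** On each component, [fill_between] distributes the prescribed y-degree within the capacities [a];
    the choices are glued along [rep]. *)
Lemma class_valid_exists a k : class_valid a k ->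
  exists2 m, vdeg m =1 a & ysum m =1 k.
Proof.
move=> /forallP akv; set S := fzero a.
have /boolp.choice[b bP] j : exists b : 'I_n -> nat,
    (forall i, b i <= a i)%N /\ (\sum_(i in comp_of adj S j) b i = k j)%N.
  have [|b' b'P b'k] := @fill_between (comp_of adj S j) a (fun=> 0%N) (k j) (fun=> leq0n _).
    rewrite big1 //=; have := akv j; case: ifP => // _ /eqP ->; exact: leq0n.
  by exists b'; split=> // i; case/andP: (b'P i).
exists (mono a (fun i => b (rep adj S i) i)).
  by move=> i; apply: vdeg_mono; case: (bP (rep adj S i)).
have e : vdeg (mono a (fun i => b (rep adj S i) i)) =1 a.
  by move=> i; apply: vdeg_mono; case: (bP (rep adj S i)).
move=> j; rewrite ysumE (_ : vzero _ = S); last first.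
  by apply/setP => i; rewrite !inE e.
case: (bP j) => _ <-; apply: eq_bigr => i; rewrite inE => /eqP ij.
by rewrite mono_y ij.
Qed.

Variable N : nat.
Local Notation E := ({ffun 'I_n -> 'I_N} * {ffun 'I_n -> 'I_N})%type.

Lemma class_family (A : {set E}) :
  (forall e, e \in A -> class_valid (nat_ffun e.1) (nat_ffun e.2)) ->
  exists2 c : E -> 'X_{1..n + n},
    forall e, e \in A -> vdeg (c e) =1 nat_ffun e.1 /\ ysum (c e) =1 nat_ffun e.2 &
    {in A &, injective (fun e => nform adj (c e))}.
Proof.
move=> Av.
have /boolp.choice[c cP] (e : E) : exists m, e \in A -> vdeg m =1 nat_ffun e.1 /\ ysum m =1 nat_ffun e.2.
  (* Outside [A] any monomial serves as a default value. *)
  have [eA|_] := boolP (e \in A); last by exists 0%MM.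
  by have [m] := class_valid_exists (Av e eA); exists m.
exists c; first exact: cP.
move=> -[a k] [a' k'] eA e'A eq_c.
have [dE yE] := cP _ eA; have [dE' yE'] := cP _ e'A; rewrite /= in dE yE dE' yE'.
congr (_, _); apply/ffunP => i; apply: val_inj.
  exact: (etrans (esym (dE i)) (etrans (nform_vdeg eq_c i) (dE' i))).
have eq_y : ysum (c (a, k)) i = ysum (c (a', k')) i by rewrite /ysum eq_c.
exact: (etrans (esym (yE i)) (etrans eq_y (yE' i))).
Qed.

Lemma class_cover (A : {set E}) (c : E -> 'X_{1..n + n}) m :
  (forall e, e \in A -> vdeg (c e) =1 nat_ffun e.1 /\ ysum (c e) =1 nat_ffun e.2) ->
  (forall i, vdeg m i < N)%N -> (forall i, ysum m i < N)%N ->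
  (forall e : E, vdeg m =1 nat_ffun e.1 -> ysum m =1 nat_ffun e.2 -> e \in A) ->
  exists2 e, e \in A & nform adj (c e) = nform adj m.
Proof.
move=> cP dN yN mA.
pose e : E := ([ffun i => Ordinal (dN i)], [ffun i => Ordinal (yN i)]).
have ed : vdeg m =1 nat_ffun e.1 by move=> i; rewrite /nat_ffun ffunE.
have ey : ysum m =1 nat_ffun e.2 by move=> i; rewrite /nat_ffun ffunE.
have eA := mA e ed ey; exists e; first exact: eA.
have [dE yE] := cP e eA.
by apply: nform_ysum => i; [rewrite dE -ed | rewrite yE -ey].
Qed.

End ClassFamilies.

(** * The classes outside the powers and the Frobenius powers *)

Section SmallClasses.

Variables (n : nat) (adj : rel 'I_n).
Hypothesis adj_sym : ssrbool.symmetric adj.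
Implicit Types (m : 'X_{1..n + n}) (S : {set 'I_n}).

(** Entries below [r] suffice, since neither a vertex degree nor a component y-degree exceeds the
    total degree. *)
Definition low_classes r : {set {ffun 'I_n -> 'I_r} * {ffun 'I_n -> 'I_r}} :=
  [set e | (\sum_i nat_ffun e.1 i < r)%N && class_valid adj (nat_ffun e.1) (nat_ffun e.2)]%SET.

Lemma ysum_le m j : (ysum adj m j <= mdeg m)%N.
Proof.
rewrite ysumE mdeg_split big_mkcond; apply: leq_sum => i _.
by case: ifP => // _; apply: leq_addl.
Qed.

Lemma vdeg_le m i : (vdeg m i <= mdeg m)%N.
Proof. by rewrite mdeg_split (bigD1 i) //= leq_addr. Qed.

Lemma low_classes_family r : exists c : _ -> 'X_{1..n + n},
  [/\ forall e, e \in low_classes r -> (mdeg (c e) < r)%N,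
      {in low_classes r &, injective (fun e => nform adj (c e))} &
      forall m, (mdeg m < r)%N ->
        exists2 e, e \in low_classes r & nform adj (c e) = nform adj m].
Proof.
have [e|c cP c_inj] := @class_family n adj r (low_classes r).
  by rewrite inE => /andP[].
exists c; split; [|exact: c_inj|] => [e eA|m mr].
  have [dE _] := cP e eA; rewrite mdeg_split (eq_bigr _ (fun i _ => dE i)).
  by move: eA; rewrite inE => /andP[].
apply: (class_cover cP) => [i|i|e ed ey].
- exact: leq_ltn_trans (vdeg_le m i) mr.
- exact: leq_ltn_trans (ysum_le m i) mr.
rewrite inE -(eq_bigr _ (fun i _ => ed i)) -mdeg_split mr /=.
have e1 : nat_ffun e.1 = vdeg m by apply/funext => i; rewrite -ed.
have e2 : nat_ffun e.2 = ysum adj m by apply/funext => i; rewrite -ey.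
by rewrite e1 e2; apply: class_valid_mon.
Qed.

(** The negation of [pow_div] in terms of degrees. A q-th power at a vertex needs vertex degree at
    least q, and total y-degree or total x-degree of its component at least q. *)
Definition frob_ok q (a k : 'I_n -> nat) := [forall (j | j \in reps adj (fzero a)),
  [forall (i | i \in comp_of adj (fzero a) j), (a i < q)%N] ||
  ((k j < q) && (comp_deg adj a j - k j < q))%N].

Lemma frob_ok_pow_div q m : (0 < q)%N -> frob_ok q (vdeg m) (ysum adj m) = ~~ pow_div adj q m.
Proof.
move=> q_gt0; apply/forall_inP/idP => [ok|].
  apply/negP => /asboolP[m' e [v qv]].
  have ed := nform_vdeg e; have eS : vzero m' = vzero m by apply: eq_vzero.
  have ey j : ysum adj m' j = ysum adj m j by rewrite /ysum e.
  have big i : (q <= m' (lshift n i))%N || (q <= m' (rshift n i))%N -> False.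
    move=> qi; have qd : (q <= vdeg m i)%N.
      by rewrite -ed; case/orP: qi => /leq_trans; apply; rewrite ?leq_addr ?leq_addl.
    have iS : i \notin vzero m by rewrite inE -lt0n (leq_trans q_gt0).
    have ci : i \in comp_of adj (vzero m) (rep adj (vzero m) i) by rewrite inE.
    have := ok (rep adj (vzero m) i); rewrite (rep_in_reps adj_sym) => /(_ iS).
    case/orP=> [/forall_inP/(_ i ci)|/andP[y_lt x_lt]]; first by rewrite ltnNge qd.
    case/orP: qi; apply/negP; rewrite -ltnNge; last first.
      apply: leq_ltn_trans y_lt; rewrite -ey ysumE eS.
      rewrite (bigD1 i ci); exact: leq_addr.
    apply: leq_ltn_trans x_lt; rewrite -ey ysumE eS /comp_deg.
    rewrite -[fzero _]/(vzero m) (eq_bigr _ (fun i _ => esym (ed i))) big_split /= addnK.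
    rewrite (bigD1 i ci); exact: leq_addr.
  by move: qv; case: (split_ordP v) => i -> qv; apply: (big i); rewrite qv ?orbT.
move=> ndiv j jS; apply: contraNT ndiv; rewrite negb_or negb_forall_in negb_and -!leqNgt.
set S := fzero (vdeg m) in jS *; set C := comp_of adj S j.
case/andP=> /exists_inP[i iC]; rewrite -leqNgt => qi qj.
(* The degrees on [C] are redistributed so that vertex [i] carries q factors y or q factors x. *)
have [b [le_b bC] qb] : exists2 b : 'I_n -> nat,
    (forall x, b x <= vdeg m x)%N /\ (\sum_(x in C) b x = ysum adj m j)%N &
    (q <= b i)%N || (q <= vdeg m i - b i)%N.
  have sum1 : (\sum_(x in C) q * (x == i) = q)%N.
    rewrite (bigD1 i) //= eqxx muln1 big1 ?addn0 // => x /andP[_ /negbTE ->].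
    by rewrite muln0.
  have le1 x : (q * (x == i) <= vdeg m x)%N.
    by case: eqVneq => [->|_]; rewrite ?muln1 ?muln0.
  have yC : (ysum adj m j <= \sum_(x in C) vdeg m x)%N.
    by rewrite ysumE; apply: leq_sum => x _; apply: leq_addl.
  case/orP: qj => qj.
    have [|b bP bC] := @fill_between n C (vdeg m) (fun x => q * (x == i))%N (ysum adj m j) le1.
      by rewrite sum1 qj.
    exists b; first by split=> // x; case/andP: (bP x).
    by case/andP: (bP i) => + _; rewrite eqxx muln1 => ->.
  (* For large x-degree the x-exponents are filled instead, and [b] is their complement in the
     vertex degrees. *)
  have [|b bP bC] := @fill_between n C (vdeg m) (fun x => q * (x == i))%N
      (comp_deg adj (vdeg m) j - ysum adj m j)%N le1.
    by rewrite sum1 qj leq_subr.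
  exists (fun x => vdeg m x - b x)%N.
    split=> [x|]; first exact: leq_subr.
    rewrite sumnB => [|x _]; last by case/andP: (bP x).
    by rewrite bC subKn.
  apply/orP; right; case/andP: (bP i) => + le; rewrite eqxx muln1 subKn //.
pose b' x := if x \in C then b x else m (rshift n x).
have le_b' x : (b' x <= vdeg m x)%N.
  by rewrite /b'; case: ifP => // _; apply: leq_addl.
apply/asboolP; exists (mono (vdeg m) b').
  have ed : vdeg (mono (vdeg m) b') =1 vdeg m by move=> x; exact: vdeg_mono.
  apply: nform_ysum => [|j']; [exact: ed | rewrite !ysumE (eq_vzero ed)].
  have [->|ne] := eqVneq j' j.
    rewrite -[vzero m]/S -/C; transitivity (\sum_(x in C) b x)%N.
      by apply: eq_bigr => x xC; rewrite mono_y /b' xC.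
    by rewrite bC ysumE.
  apply: eq_bigr => x; rewrite inE mono_y /b' => /eqP xj'.
  by rewrite inE xj' (negbTE ne).
case/orP: qb => qb; [exists (rshift n i) | exists (lshift n i)].
  by rewrite mono_y /b' iC.
by rewrite mono_x /b' iC.
Qed.

(** The bound: all exponents of a monomial outside the Frobenius power are below q, so its total
    degree is at most 2 q n, which is less than 2 q (n + 1). *)
Definition frob_classes q :
    {set {ffun 'I_n -> 'I_(2 * q * n.+1)} * {ffun 'I_n -> 'I_(2 * q * n.+1)}} :=
  [set e | frob_ok q (nat_ffun e.1) (nat_ffun e.2) && class_valid adj (nat_ffun e.1) (nat_ffun e.2)]%SET.

Lemma frob_classes_family q : (0 < q)%N -> exists c : _ -> 'X_{1..n + n},
  [/\ forall e, e \in frob_classes q -> ~~ pow_div adj q (c e),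
      {in frob_classes q &, injective (fun e => nform adj (c e))} &
      forall m, ~~ pow_div adj q m ->
        exists2 e, e \in frob_classes q & nform adj (c e) = nform adj m].
Proof.
move=> q_gt0.
have [e|c cP c_inj] := @class_family n adj _ (frob_classes q).
  by rewrite inE => /andP[].
exists c; split; [|exact: c_inj|] => [e eA|m mq].
  have [dE yE] := cP e eA; rewrite -frob_ok_pow_div //.
  have -> : vdeg (c e) = nat_ffun e.1 by apply/funext.
  have -> : ysum adj (c e) = nat_ffun e.2 by apply/funext.
  by move: eA; rewrite inE => /andP[].
have mv v : (m v < q)%N.
  rewrite ltnNge; apply: contra mq => qv; apply/asboolP; exists m => //; by exists v.
have dq i : (vdeg m i <= 2 * q)%N by rewrite mul2n -addnn; apply: leq_add; apply: ltnW.
apply: (class_cover cP) => [i|i|e ed ey].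
- rewrite /vdeg; move: (mv (lshift n i)) (mv (rshift n i)); nia.
- apply: leq_ltn_trans (ysum_le m i) _; rewrite mdeg_split.
  apply: (@leq_ltn_trans (\sum_(i < n) 2 * q)%N); first exact: leq_sum.
  rewrite sum_nat_const card_ord mulnC ltn_mul2l ltnSn andbT; lia.
rewrite inE.
have e1 : nat_ffun e.1 = vdeg m by apply/funext => i; rewrite -ed.
have e2 : nat_ffun e.2 = ysum adj m by apply/funext => i; rewrite -ey.
by rewrite e1 e2 (frob_ok_pow_div m q_gt0) mq; apply: class_valid_mon.
Qed.

End SmallClasses.

(** * Sums over bounded functions *)

Section FfunSums.

Variables (I : finType) (N : nat).
Implicit Type a : {ffun I -> 'I_N}.

Lemma sum_interval (lo hi : nat) :
  (\sum_(t < N) (lo <= t < hi) = minn hi N - lo)%N.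
Proof.
elim: {+}N => [|M IHM]; first by rewrite big_ord0 minn0 sub0n.
rewrite big_ord_recr /= IHM.
case: (leqP lo M) => h1; case: (ltnP M hi) => h2 /=; lia.
Qed.

(** For a fixed first entry the conditions on the second are independent over [j], so each fibre is
    a product. *)
Lemma card_ffun_pairs (P : pred {ffun I -> 'I_N}) (V : {ffun I -> 'I_N} -> I -> pred nat) :
  #|[set e : {ffun I -> 'I_N} * {ffun I -> 'I_N} |
      P e.1 && [forall j, V e.1 j (e.2 j)]]%SET| =
  (\sum_(a | P a) \prod_j \sum_(t < N) V a j t)%N.
Proof.
rewrite -sum1_card big_mkcond.
rewrite (eq_bigr (fun e : {ffun I -> 'I_N} * {ffun I -> 'I_N} => if P e.1 then \prod_j V e.1 j (e.2 j) else 0)%N); last first.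
  move=> [a k] _; rewrite inE /=; case: (P a) => //=.
  case: ifPn => [/forallP Vk|]; first by rewrite big1 // => j _; rewrite Vk.
  by rewrite negb_forall => /existsP[j /negbTE Vj]; rewrite (bigD1 j) //= Vj.
rewrite -(pair_bigA _ (fun a (k : {ffun I -> 'I_N}) => if P a then \prod_j V a j (k j) else 0)%N) /=.
rewrite [RHS]big_mkcond; apply: eq_bigr => a _; case: (P a); last by rewrite big1.
by rewrite bigA_distr_bigA.
Qed.

Definition nzsupp a : {set I} := [set i | a i != 0%N :> nat]%SET.

(** Expanding the product gives the functions equal to a default off [C]. With default 0 and nonzero
    values on [C], these are the functions with support exactly [C]. *)
Lemma sum_nzsupp_prod (R : comNzRingType) (N_gt0 : (0 < N)%N) (C : {set I})
    (Q : I -> pred 'I_N) (g : 'I_N -> R) :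
  \sum_(a | (nzsupp a == C) && [forall (i | i \in C), Q i (a i)])
      \prod_(i in C) g (a i) =
  \prod_(i in C) \sum_(t : 'I_N | (t != 0%N :> nat) && Q i t) g t.
Proof.
rewrite (big_distr_big_dep (Ordinal N_gt0)); apply: eq_bigl => a.
apply/andP/pfamilyP => [[/eqP aC /forall_inP aQ]|[aC aQ]].
  split=> [|i iC].
    apply/fintype.subsetP => i; rewrite inE -aC inE.
    by apply: contraNneq => ai; apply/eqP/val_inj.
  by rewrite -topredE /= aQ // andbT; move: iC; rewrite -{1}aC inE.
have aQ' i : i \in C -> (a i != 0%N :> nat) && Q i (a i) by move=> /aQ.
split; last by apply/forall_inP => i /aQ' /andP[].
apply/eqP/setP => i; rewrite inE; apply/idP/idP => [ai|/aQ' /andP[]//].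
move/fintype.subsetP: aC; apply; rewrite inE.
by apply: contraNneq ai => ->.
Qed.

End FfunSums.

(** * Factorization of sums over the connected components *)

Section ComponentSums.

Variables (n : nat) (adj : rel 'I_n).
Hypothesis adj_sym : ssrbool.symmetric adj.
Variables (R : comNzRingType) (N : nat).
Hypothesis N_gt0 : (0 < N)%N.
Implicit Types (S C : {set 'I_n}) (a : {ffun 'I_n -> 'I_N}).

Lemma sum_ffun_fzero S (G : {set 'I_n} -> {ffun 'I_n -> 'I_N} -> R) :
  (forall C a a', {in C, a =1 a'} -> G C a = G C a') ->
  \sum_(a | fzero (nat_ffun a) == S) \prod_(j in reps adj S) G (comp_of adj S j) a =
  \prod_(j in reps adj S) \sum_(a | nzsupp a == comp_of adj S j) G (comp_of adj S j) a.
Proof.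
move=> G_local; pose z : 'I_N := Ordinal N_gt0.
(* A function with zero set [S] corresponds to one function per component, with that component as
   support: [glue] and [cut] are the two directions. *)
pose glue (f : {ffun 'I_n -> {ffun 'I_n -> 'I_N}}) := [ffun i => f (rep adj S i) i].
pose cut a := [ffun j => if j \in reps adj S
  then [ffun i => if i \in comp_of adj S j then a i else z] else [ffun=> z]].
rewrite (big_distr_big_dep [ffun=> z]) (reindex_onto glue cut) /=; last first.
  move=> a /eqP aS; apply/ffunP => i; rewrite !ffunE (rep_in_reps adj_sym).
  case: ifPn => [iS|]; first by rewrite ffunE inE eqxx.
  rewrite negbK ffunE -{1}aS inE => /eqP ai; apply: val_inj.
  exact: esym ai.
have z0 (t : 'I_N) : (t == 0%N :> nat) = (t == z) by [].
apply: eq_big => [f|f /andP[/eqP fS /eqP fcut]]; last first.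
  apply: eq_bigr => j jS; apply: G_local => i; rewrite inE => /eqP ij.
  by rewrite ffunE ij.
apply/andP/pfamilyP => [[/eqP fS /eqP fcut]|[fsupp fQ]].
  have fE j : f j = cut (glue f) j by rewrite fcut.
  split=> [|j jS].
    apply/fintype.subsetP => j; rewrite inE; apply: contraR => jS.
    by rewrite fE ffunE (negbTE jS).
  rewrite -topredE /=; apply/eqP/setP => i; rewrite inE fE ffunE jS ffunE.
  case: ifPn => [ij|_]; last by rewrite z0 eqxx.
  by have := comp_of_notin adj_sym jS ij; rewrite -{1}fS inE.
have f0 j : j \notin reps adj S -> f j = [ffun=> z].
  by move=> jS; apply/eqP; apply: contraNT jS => fj; move/fintype.subsetP: fsupp; apply.
have fC j i : j \in reps adj S -> (f j i != 0%N :> nat) = (i \in comp_of adj S j).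
  by move=> /fQ; rewrite -topredE /= => /eqP/setP/(_ i); rewrite inE.
split; apply/eqP.
  apply/setP => i; rewrite inE /nat_ffun ffunE; apply/idP/idP => [|iS].
    apply: contraLR => iS; rewrite fC ?(rep_in_reps adj_sym) //.
    by rewrite inE.
  by rewrite f0 ?ffunE // (rep_in_reps adj_sym) negbK.
apply/ffunP => j; rewrite ffunE; case: ifPn => [jS|/f0 ->//].
apply/ffunP => i; rewrite !ffunE.
case: ifPn => [|ij]; first by rewrite inE => /eqP ->.
by apply/esym/eqP; rewrite -z0 -[_ == _]negbK fC.
Qed.

Lemma sum_ffun_components (G : {set 'I_n} -> {ffun 'I_n -> 'I_N} -> R) :
  (forall C a a', {in C, a =1 a'} -> G C a = G C a') ->
  \sum_a \prod_(j in reps adj (fzero (nat_ffun a)))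
     G (comp_of adj (fzero (nat_ffun a)) j) a =
  \sum_S \prod_(C in components adj S) \sum_(a | nzsupp a == C) G C a.
Proof.
move=> G_local; rewrite (partition_big (fun a => fzero (nat_ffun a)) predT) //=.
apply: eq_bigr => S _; rewrite (big_components adj_sym) -sum_ffun_fzero //.
by apply: eq_bigr => a /eqP ->.
Qed.

End ComponentSums.

(** * Truncated generating functions and their partial coefficient sums *)

Section PartialSums.

Variable R : comNzRingType.
Implicit Types p Q : {poly R}.

(** For positive [M], the coefficient of X^(M - 1) in the series Q / (1 - X). *)
Definition psum Q M : R := \sum_(k < M) Q`_k.

Lemma psumS Q M : psum Q M.+1 = psum Q M + Q`_M.
Proof. exact: big_ord_recr. Qed.

Lemma psum_sum (I : Type) (s : seq I) (P : pred I) (F : I -> {poly R}) M :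
  psum (\sum_(i <- s | P i) F i) M = \sum_(i <- s | P i) psum (F i) M.
Proof.
rewrite /psum exchange_big /=; apply: eq_bigr => k _.
by rewrite coef_sum.
Qed.

Lemma psumZ c Q M : psum (c *: Q) M = c * psum Q M.
Proof. by rewrite /psum mulr_sumr; apply: eq_bigr => k _; rewrite coefZ. Qed.

Lemma psumXn k M : psum 'X^k M = (k < M)%:R.
Proof.
elim: M => [|M IHM]; first by rewrite /psum big_ord0.
rewrite psumS IHM coefXn -natrD ltnS.
by case: (ltngtP k M).
Qed.

Lemma psumM p Q M : psum (p * Q) M = \sum_(j < M) p`_j * psum Q (M - j).
Proof.
elim: M => [|M IHM]; first by rewrite /psum !big_ord0.
rewrite psumS IHM coefM.
have -> : \sum_(j < M) p`_j * psum Q (M - j) = \sum_(j < M.+1) p`_j * psum Q (M - j).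
  by rewrite big_ord_recr /= subnn /psum big_ord0 mulr0 addr0.
rewrite -big_split; apply: eq_bigr => j _ /=.
have jM : (j <= M)%N by rewrite -ltnS.
by rewrite subSn // psumS mulrDr.
Qed.

(** The hockey-stick identity; [b <= j] removes the boundary term ['C(b, j.+1)]. *)
Lemma sum_bin_shift b j M : (b <= j)%N -> (\sum_(u < M) 'C(u + b, j) = 'C(M + b, j.+1))%N.
Proof.
move=> bj; elim: M => [|M IHM]; first by rewrite big_ord0 bin_small.
by rewrite big_ord_recr /= IHM addSn binS.
Qed.

Lemma sum_bin_rev b j M : (b <= j)%N ->
  (\sum_(t < M.+1) 'C(M - t + b, j) = 'C(M.+1 + b, j.+1))%N.
Proof.
move=> bj; rewrite -sum_bin_shift // (reindex_inj rev_ord_inj) /=.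
by apply: eq_bigr => t _; rewrite subSS subKn // -ltnS.
Qed.

Lemma sum_bin_weighted b j M : (b <= j)%N ->
  (\sum_(t < M.+1) t * 'C(M - t + b, j) = 'C(M + b.+1, j.+2))%N.
Proof.
move=> bj; elim: M => [|M IHM].
  by rewrite big_ord1 mul0n bin_small //; lia.
rewrite big_ord_recl mul0n add0n.
under eq_bigr => t _ do rewrite lift0 subSS mulSn.
by rewrite big_split /= IHM sum_bin_rev // addSnnS addSn binS addnC.
Qed.

Variable N : nat.

(** A truncation of X^lo / (1 - X), with the same coefficients below degree [N]. *)
Definition interval_poly lo : {poly R} := \sum_(t < N | (lo <= t)%N) 'X^t.

Lemma coef_interval_poly lo j : (interval_poly lo)`_j = (lo <= j < N)%:R.
Proof.
rewrite coef_sum; case: (ltnP j N) => jN.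
  rewrite big_mkcond (bigD1 (Ordinal jN)) //= big1 => [|t tj].
    by rewrite addr0 andbT; case: ifP; rewrite ?coefXn ?eqxx.
  move: tj; rewrite -val_eqE /= eq_sym => /negbTE jt.
  by case: ifP => // _; rewrite coefXn jt.
rewrite andbF big1 // => t _; rewrite coefXn gtn_eqF //.
exact: leq_trans (ltn_ord t) jN.
Qed.

Lemma psum_interval lo Q b j M : (b <= j)%N -> (M < N)%N ->
  (forall M', M' <= M -> psum Q M'.+1 = 'C(M' + b, j)%:R)%N ->
  psum (interval_poly lo.+1 * Q) M.+1 = 'C(M - lo + b, j.+1)%:R.
Proof.
move=> bj MN HQ; rewrite psumM.
have [loM|Mlo] := leqP M lo.
  rewrite (eqP loM) bin_small // big1 // => t _.
  rewrite coef_interval_poly ltnNge (leq_trans _ loM) ?mul0r // -ltnS.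
  exact: ltn_ord.
transitivity ((\sum_(t < M.+1 | lo < t) 'C(M - t + b, j))%N%:R : R).
  rewrite natr_sum [RHS]big_mkcond; apply: eq_bigr => t _.
  have tM : (t <= M)%N by rewrite -ltnS.
  rewrite coef_interval_poly (leq_ltn_trans tM MN) andbT subSn // HQ ?leq_subr //.
  by case: ifP; rewrite ?mul1r ?mul0r.
congr (_%:R); rewrite -sum_bin_shift // (big_ord_widen M.+1 (fun u => 'C(u + b, j))) //; last first.
  by rewrite leqW ?leq_subr.
rewrite [RHS](reindex_inj rev_ord_inj); apply: eq_big => t; last by rewrite /= subSS.
by have := ltn_ord t; rewrite /= subSS; lia.
Qed.

(** [p0] and [p1] stand for X / (1 - X) and X / (1 - X)^2. *)
Let p0 := interval_poly 1.
Let p1 := 'X * p0^`().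

Lemma coef_p1 j : p1`_j = ((j < N) * j)%:R.
Proof.
rewrite coefXM; case: j => [|j]; first by rewrite muln0.
by rewrite coef_deriv coef_interval_poly /= natrM mulr_natr.
Qed.

Lemma psum_p1 Q b j M : (b <= j)%N -> (M < N)%N ->
  (forall M', M' <= M -> psum Q M'.+1 = 'C(M' + b, j)%:R)%N ->
  psum (p1 * Q) M.+1 = 'C(M + b.+1, j.+2)%:R.
Proof.
move=> bj MN HQ; rewrite psumM -sum_bin_weighted // natr_sum.
apply: eq_bigr => t _; have tM : (t <= M)%N by rewrite -ltnS.
by rewrite coef_p1 (leq_ltn_trans tM MN) mul1n subSn // HQ ?leq_subr // natrM.
Qed.

(** As series, the value is the coefficient of X^M in X^(a + b) / (1 - X)^(a + 2 b + 1). *)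
Lemma psum_pow a b M : (M < N)%N ->
  psum (p1 ^+ b * p0 ^+ a) M.+1 = 'C(M + b, a + b.*2)%:R.
Proof.
elim: b M => [|b IHb] M MN.
  rewrite expr0 mul1r; elim: a M MN => [|a IHa] M MN.
    by rewrite expr0 -(expr0 'X) psumXn bin0.
  rewrite exprS (@psum_interval 0 _ 0 a) ?subn0 ?addn0 ?addn0 //.
  by move=> M' M'M; rewrite IHa ?addn0 // (leq_ltn_trans M'M).
rewrite exprS -mulrA (@psum_p1 _ b (a + b.*2)) ?doubleS ?addnS //; first by lia.
by move=> M' M'M; rewrite IHb // (leq_ltn_trans M'M).
Qed.

Lemma psum_interval_pow lo a M : (M < N)%N ->
  psum (interval_poly lo.+1 * p0 ^+ a) M.+1 = 'C(M - lo, a.+1)%:R.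
Proof.
move=> MN; rewrite -[(M - lo)%N]addn0 (@psum_interval lo _ 0 a) // => M' M'M.
by rewrite -[p0 ^+ a]mul1r -(expr0 p1) psum_pow ?(leq_ltn_trans M'M) ?addn0.
Qed.

Lemma deriv_mulX_pow lo s : ('X * interval_poly lo ^+ s)^`() =
  interval_poly lo ^+ s +
  ('X * (interval_poly lo)^`() * interval_poly lo ^+ s.-1) *+ s :> {poly R}.
Proof. by rewrite derivM derivX mul1r deriv_exp mulrnAr mulrA. Qed.

End PartialSums.

(** * Generating functions for the class counts *)

Section ClassCounts.

Variables (n : nat) (adj : rel 'I_n).
Hypothesis adj_sym : ssrbool.symmetric adj.
Implicit Types (S C J : {set 'I_n}).

Definition deg_on N C (a : {ffun 'I_n -> 'I_N}) := (\sum_(i in C) a i)%N.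

Lemma deg_on_eq N C (a a' : {ffun 'I_n -> 'I_N}) : {in C, a =1 a'} -> deg_on C a = deg_on C a'.
Proof. by move=> e; apply: eq_bigr => i /e ->. Qed.

Lemma sum_deg_on N (a : {ffun 'I_n -> 'I_N}) :
  (\sum_(j in reps adj (fzero (nat_ffun a))) deg_on (comp_of adj (fzero (nat_ffun a)) j) a =
   \sum_i a i)%N.
Proof.
rewrite /deg_on (sum_comp_of adj_sym _ (fun i => nat_of_ord (a i))).
rewrite big_mkcond; apply: eq_bigr => i _.
by rewrite inE; case: eqP => //= ->.
Qed.

Lemma prod_reps S (F : 'I_n -> nat) : (forall j, j \notin reps adj S -> F j = 1)%N ->
  (\prod_j F j = \prod_(j in reps adj S) F j)%N.
Proof.
move=> F1; rewrite [RHS]big_mkcond; apply: eq_bigr => j _.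
by case: ifPn => // /F1.
Qed.

Lemma sum_eq0_ord N : (0 < N)%N -> (\sum_(t < N) (t == 0 :> nat) = 1)%N.
Proof. by case: N => // N _; rewrite big_ord_recl big1. Qed.

Lemma card_low_classes r :
  #|low_classes adj r.+1| =
  (\sum_(a : {ffun 'I_n -> 'I_r.+1} | \sum_i a i < r.+1)
     \prod_(j in reps adj (fzero (nat_ffun a)))
       (deg_on (comp_of adj (fzero (nat_ffun a)) j) a).+1)%N.
Proof.
pose V (a : {ffun 'I_n -> 'I_r.+1}) j t :=
  if j \in reps adj (fzero (nat_ffun a)) then (t <= comp_deg adj (nat_ffun a) j)%N else t == 0%N.
rewrite [LHS](card_ffun_pairs (fun a => \sum_i nat_ffun a i < r.+1)%N V).
apply: eq_bigr => a ar; rewrite (@prod_reps (fzero (nat_ffun a))) => [|j jS].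
  apply: eq_bigr => j jS.
  rewrite (eq_bigr (fun t : 'I_r.+1 =>
    0 <= t < (deg_on (comp_of adj (fzero (nat_ffun a)) j) a).+1 : nat)%N); last first.
    by move=> t _; rewrite /V jS /= ltnS.
  rewrite sum_interval subn0; apply/minn_idPl; apply: leq_trans ar; rewrite ltnS.
  by rewrite -[X in (_ <= X)%N]sum_deg_on (bigD1 j jS) leq_addr.
rewrite (eq_bigr (fun t : 'I_r.+1 => t == 0 :> nat : nat)%N); first exact: sum_eq0_ord.
by move=> t _; rewrite /V (negbTE jS).
Qed.

Section Generating.

Variable R : comNzRingType.

Lemma sum_nzsupp_deg N C (P : pred 'I_N) : (0 < N)%N ->
  \sum_(a : {ffun 'I_n -> 'I_N} | (nzsupp a == C) && [forall (i | i \in C), P (a i)])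
     'X^(deg_on C a) =
  (\sum_(t : 'I_N | (t != 0%N :> nat) && P t) 'X^t) ^+ #|C| :> {poly R}.
Proof.
move=> N_gt0; rewrite -prodr_const.
rewrite -(sum_nzsupp_prod N_gt0 C (fun=> P) (fun t : 'I_N => 'X^t : {poly R})).
by apply: eq_bigr => a _; rewrite -prodrXr.
Qed.

(** The weight is the number of possible y-degrees of a component of given degree; differentiating
    X^(deg + 1) produces it. *)
Lemma sum_nzsupp_deriv N C (P : pred 'I_N) : (0 < N)%N ->
  \sum_(a : {ffun 'I_n -> 'I_N} | (nzsupp a == C) && [forall (i | i \in C), P (a i)])
     (deg_on C a).+1%:R *: 'X^(deg_on C a) =
  ('X * (\sum_(t : 'I_N | (t != 0%N :> nat) && P t) 'X^t) ^+ #|C|)^`() :> {poly R}.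
Proof.
move=> N_gt0; rewrite -sum_nzsupp_deg // mulr_sumr raddf_sum; apply: eq_bigr => a _ /=.
by rewrite -exprS derivXn scaler_nat.
Qed.

(** Exponents of X add up over the components to the total degree, so the bound on that degree
    becomes a partial coefficient sum. *)
Lemma low_classes_psum r :
  #|low_classes adj r.+1|%:R =
  psum (\sum_S \prod_(C in components adj S) ('X * interval_poly R r.+1 1 ^+ #|C|)^`()) r.+1.
Proof.
pose G C (a : {ffun 'I_n -> 'I_r.+1}) : {poly R} := (deg_on C a).+1%:R *: 'X^(deg_on C a).
rewrite card_low_classes.
have -> : \sum_S \prod_(C in components adj S) ('X * interval_poly R r.+1 1 ^+ #|C|)^`() =
    \sum_a \prod_(j in reps adj (fzero (nat_ffun a)))
      G (comp_of adj (fzero (nat_ffun a)) j) a.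
  rewrite (sum_ffun_components adj_sym) // => [|C a a' e]; last by rewrite /G (deg_on_eq e).
  apply: eq_bigr => S _; apply: eq_bigr => C _.
  have -> : interval_poly R r.+1 1 = \sum_(t : 'I_r.+1 | (t != 0%N :> nat) && predT t) 'X^t.
    by apply: eq_bigl => t; rewrite andbT lt0n.
  rewrite -sum_nzsupp_deriv //; apply: eq_bigl => a.
  by rewrite (_ : [forall (_ | _), _]) ?andbT //; apply/forall_inP.
rewrite psum_sum natr_sum big_mkcond; apply: eq_bigr => a _.
rewrite /G scaler_prod prodrXr sum_deg_on psumZ psumXn natr_prod.
by case: ifP; rewrite ?mulr1 ?mulr0.
Qed.

Lemma prod_subset_distr (I : finType) (A : {set I}) (f g : I -> R) :
  \prod_(i in A) (f i + g i) =
  \sum_(J : {set I} | J \subset A) \prod_(i in J) g i * \prod_(i in A :\: J) f i.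
Proof.
rewrite big_mkcond /=.
rewrite (eq_bigr (fun i => (if i \in A then g i else 0) + (if i \in A then f i else 1))); last first.
  by move=> i _; case: ifP; rewrite ?add0r // addrC.
rewrite bigA_distr [RHS]big_mkcond; apply: eq_bigr => J _.
case: ifPn => [/fintype.subsetP JA|]; last first.
  case/subsetPn => i iJ iA; rewrite (bigD1 i) //= iJ (negbTE iA) mul0r //.
rewrite [X in _ = X * _]big_mkcond [X in _ = _ * X]big_mkcond -big_split /=.
apply: eq_bigr => i _; rewrite inE.
by have [/JA ->|_] := boolP (i \in J); rewrite /= ?mulr1 ?mul1r //.
Qed.

End Generating.

End ClassCounts.

(** * Closed formulas for the class counts *)

Section ExactCounts.

Variables (n : nat) (adj : rel 'I_n).
Hypothesis adj_sym : ssrbool.symmetric adj.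
Implicit Types (S C J : {set 'I_n}).

Lemma comp_of_gt0 S j : j \in reps adj S -> (0 < #|comp_of adj S j|)%N.
Proof.
by move=> jS; apply/card_gt0P; exists j; move: jS; rewrite !inE => /andP[].
Qed.

Lemma sum_card_comp_of S : (\sum_(j in reps adj S) #|comp_of adj S j| = #|~: S|)%N.
Proof.
rewrite -sum1_card; under eq_bigr => j _ do rewrite -sum1_card.
by rewrite (sum_comp_of adj_sym); apply: eq_bigl => i; rewrite inE.
Qed.

(** With s the size of a component, its factor is [p0 ^+ s + s p1 p0 ^+ (s - 1)]; [J] collects the
    components that contribute the second term. *)
Lemma card_low_classesE r :
  #|low_classes adj r.+1| =
  (\sum_S \sum_(J : {set 'I_n} | J \subset reps adj S)
    (\prod_(j in J) #|comp_of adj S j|) * 'C(r + #|J|, #|~: S| + #|J|))%N.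
Proof.
apply/eqP; rewrite -(eqr_nat int) (low_classes_psum adj_sym) psum_sum natr_sum; apply/eqP.
apply: eq_bigr => S _; rewrite (big_components adj_sym).
pose s j := #|comp_of adj S j|; pose p0 := interval_poly int r.+1 1.
pose p1 := 'X * p0^`().
under eq_bigr => j _ do rewrite deriv_mulX_pow -/p0 -/p1 -/(s j).
rewrite prod_subset_distr psum_sum natr_sum; apply: eq_bigr => J JA.
rewrite prodrMn mulrnAl -scaler_nat psumZ natrM; congr (_ * _).
rewrite big_split /= prodr_const !prodrXr -mulrA -exprD psum_pow //.
(* The exponent of [p0] is |~S| - |J| and that of [p1] is |J|, which gives |~S| + |J| in
   [psum_pow]. *)
congr (('C(_, _))%:R); rewrite -addnn addnA; congr (_ + _)%N.
rewrite -(sum_card_comp_of S) [RHS](big_setID J) /= (finset.setIidPr JA) addnAC.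
congr (_ + _)%N; rewrite -[X in (_ + X)%N]sum1_card -big_split /=.
apply: eq_bigr => j /(fintype.subsetP JA) jA.
by rewrite addn1 prednK // comp_of_gt0.
Qed.

(* (q-1)^s (1 + s q / 2) + s 'C(q, s+1) without the division by 2. *)
Definition frob_count q s := ((q.-1) ^ s + s * (q.-1 ^ s.-1 * 'C(q, 2)) + s * 'C(q, s.+1))%N.

(** The number of y-degrees allowed by [frob_ok] on a component. In the second case they lie
    strictly between deg - q and q, and the truncated subtraction gives 0 when there are none. *)
Definition frob_weight q N C (a : {ffun 'I_n -> 'I_N}) :=
  if [forall (i | i \in C), (a i < q)%N] then (deg_on C a).+1 else (q.*2.-1 - deg_on C a)%N.

Lemma card_frob_classes q : (0 < q)%N ->
  #|frob_classes adj q| =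
  (\sum_(a : {ffun 'I_n -> 'I_(2 * q * n.+1)})
     \prod_(j in reps adj (fzero (nat_ffun a)))
       frob_weight q (comp_of adj (fzero (nat_ffun a)) j) a)%N.
Proof.
move=> q_gt0; set N := (2 * q * n.+1)%N.
have qN : (q <= N)%N by rewrite /N; nia.
pose ok (a : {ffun 'I_n -> 'I_N}) j :=
  [forall (i | i \in comp_of adj (fzero (nat_ffun a)) j), (a i < q)%N].
pose V (a : {ffun 'I_n -> 'I_N}) j t :=
  if j \in reps adj (fzero (nat_ffun a))
  then (t <= comp_deg adj (nat_ffun a) j)%N &&
    (ok a j || ((t < q) && (comp_deg adj (nat_ffun a) j - t < q))%N)
  else t == 0%N.
have -> : #|frob_classes adj q| =
    #|[set e : {ffun 'I_n -> 'I_N} * {ffun 'I_n -> 'I_N} |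
      predT e.1 && [forall j, V e.1 j (e.2 j)]]%SET|.
  apply: eq_card => e; rewrite !inE /=.
  apply/andP/forallP => [[/forall_inP fe /forallP ve] j|Ve].
    rewrite /V; have := ve j; case: ifP => [jS ->|_ //]; exact: fe.
  split; [apply/forall_inP => j jS | apply/forallP => j]; have := Ve j; rewrite /V.
    by rewrite jS => /andP[].
  by case: ifP => // _ /andP[].
rewrite card_ffun_pairs; apply: eq_bigr => a _.
rewrite (@prod_reps _ adj (fzero (nat_ffun a))) => [|j jS]; last first.
  rewrite (eq_bigr (fun t : 'I_N => t == 0 :> nat : nat)%N); last first.
    by move=> t _; rewrite /V (negbTE jS).
  by apply: sum_eq0_ord; apply: leq_trans qN.
apply: eq_bigr => j jS; rewrite /frob_weight -/(ok a j).
set C := comp_of _ _ _; case: ifPn => [aj|].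
  rewrite (eq_bigr (fun t : 'I_N => 0 <= t < (deg_on C a).+1 : nat)%N); last first.
    by move=> t _; rewrite /V jS aj andbT /= ltnS.
  rewrite sum_interval subn0; apply/minn_idPl.
  have le_aq : (deg_on C a <= n * q)%N.
    rewrite -[in X in (_ <= X * q)%N](card_ord n) -sum_nat_const /deg_on big_mkcond.
    apply: leq_sum => i _; case: ifP => // iC; apply: ltnW.
    by move/forall_inP: aj; apply.
  apply: leq_ltn_trans le_aq _; rewrite /N; nia.
rewrite negb_forall_in => aj.
have le_qa : (q <= deg_on C a)%N.
  case/exists_inP: aj => i iC; rewrite -leqNgt => /leq_trans; apply.
  by rewrite /deg_on (bigD1 i) //= leq_addr.
have okF : ok a j = false.
  by apply/negbTE; rewrite negb_forall_in.
(* Since q is at most the degree, [t < q] implies the bound of [t] by the degree. *)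
rewrite (eq_bigr (fun t : 'I_N => (deg_on C a).+1 - q <= t < q : nat)%N); last first.
  move=> t _; rewrite /V jS okF /= -[comp_deg _ _ _]/(deg_on C a).
  congr (nat_of_bool _); move: (deg_on C a) le_qa => c qc.
  apply/idP/idP => /andP[]; lia.
rewrite sum_interval; lia.
Qed.

(** Rewrites a truncated weight as a sum of threshold conditions, each of which is a partial
    coefficient sum. *)
Lemma sum_lt_ord M u : (\sum_(k < M) (u < k.+1) = M - u)%N.
Proof.
elim: M => [|M IHM]; first by rewrite big_ord0.
rewrite big_ord_recr /= IHM ltnS; case: leqP; lia.
Qed.

Lemma frob_weight_split q N C (a : {ffun 'I_n -> 'I_N}) : nzsupp a = C ->
  (frob_weight q C a =
   (if [forall (i | i \in C), (a i < q)%N] then (deg_on C a).+1 else 0) +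
   \sum_(i in C | q <= a i) \sum_(k < q.*2.-1) (deg_on C a < k.+1))%N.
Proof.
move=> aC; rewrite /frob_weight; under eq_bigr => i _ do rewrite sum_lt_ord.
case: ifPn => [/forall_inP aq|].
  by rewrite big1 ?addn0 // => i /andP[/aq ai]; rewrite leqNgt ai.
rewrite negb_forall_in => /exists_inP[i iC]; rewrite -leqNgt => qi.
rewrite add0n (bigD1 i) /=; last by rewrite iC qi.
have [deg0|deg_lt] := leqP q.*2.-1 (deg_on C a).
  move: deg0; rewrite -subn_eq0 => /eqP ->.
  by rewrite big1.
(* Two vertices of degree at least q force deg_on C a >= 2q. *)
rewrite big1 ?addn0 // => i' /andP[/andP[i'C qi'] ne].
move: deg_lt; rewrite /deg_on (bigD1 i) //= (bigD1 i') /= ?i'C //; lia.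
Qed.

(** Evaluation of [sum_nzsupp_deriv] at 1, where X + ... + X^(q - 1) takes the value q - 1 and its
    derivative the value ['C(q, 2)]. *)
Lemma sum_frob_weight_small (R : comNzRingType) q N C : (0 < q <= N)%N ->
  \sum_(a : {ffun 'I_n -> 'I_N} | (nzsupp a == C) && [forall (i | i \in C), (a i < q)%N])
     (deg_on C a).+1%:R =
  (q.-1 ^ #|C| + #|C| * (q.-1 ^ #|C|.-1 * 'C(q, 2)))%:R :> R.
Proof.
case/andP=> q_gt0 qN; have N_gt0 : (0 < N)%N by apply: leq_trans qN.
have := congr1 (fun p : {poly R} => p.[1])
  (sum_nzsupp_deriv R C (fun t : 'I_N => (t < q)%N) N_gt0).
rewrite horner_sum; under eq_bigr => a _ do rewrite hornerZ hornerXn expr1n mulr1.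
move=> ->.
have -> : \sum_(t : 'I_N | (t != 0%N :> nat) && (t < q)%N) 'X^t = interval_poly R q 1.
  rewrite /interval_poly big_mkcond [RHS]big_mkcond.
  rewrite (big_ord_widen N (fun t => if (0 < t)%N then 'X^t else 0 : {poly R})) //.
  rewrite [RHS]big_mkcond; apply: eq_bigr => t _; rewrite -lt0n.
  by case: (0 < t)%N; case: (t < q)%N.
have e0 : (interval_poly R q 1).[1] = q.-1%:R.
  rewrite horner_sum -(prednK q_gt0) big_mkcond big_ord_recl /= add0r.
  by under eq_bigr => t _ do rewrite hornerXn expr1n; rewrite sumr_const card_ord.
have e1 : (interval_poly R q 1)^`().[1] = 'C(q, 2)%:R.
  rewrite raddf_sum horner_sum -bin2_sum natr_sum big_mkord big_mkcond.
  apply: eq_bigr => t _; case: ifP => /= [_|].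
    by rewrite derivXn hornerMn hornerXn expr1n.
  by rewrite lt0n => /negbFE/eqP ->.
rewrite deriv_mulX_pow !(hornerD, hornerMn, hornerM, hornerX, horner_exp) e0 e1.
rewrite mul1r natrD natrX natrM natrM natrX -[X in _ + X]mulr_natl.
by rewrite ['C(q, 2)%:R * _]mulrC.
Qed.

(** The vertex [i] contributes [interval_poly q] and the others [p0]; [psum_interval_pow] evaluates
    each threshold, and a hockey-stick sum over the thresholds finishes. *)
Lemma sum_frob_weight_big q N C i : (0 < q)%N -> (q.*2.-1 <= N)%N -> i \in C ->
  (\sum_(a : {ffun 'I_n -> 'I_N} | (nzsupp a == C) && (q <= a i))
    \sum_(k < q.*2.-1) (deg_on C a < k.+1) = 'C(q, #|C|.+1))%N.
Proof.
move=> q_gt0 qN iC; have N_gt0 : (0 < N)%N by lia.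
apply/eqP; rewrite -(eqr_nat int) exchange_big natr_sum; apply/eqP.
pose Q (i' : 'I_n) (t : 'I_N) := (i' == i) ==> (q <= t)%N.
have gen : \sum_(a : {ffun 'I_n -> 'I_N} | (nzsupp a == C) && (q <= a i)%N) 'X^(deg_on C a) =
    interval_poly int N q * interval_poly int N 1 ^+ #|C|.-1.
  transitivity (\prod_(i' in C) \sum_(t : 'I_N | (t != 0%N :> nat) && Q i' t) 'X^t : {poly int}).
    rewrite -sum_nzsupp_prod //; apply: eq_big => [a|a _]; last by rewrite -prodrXr.
    congr (_ && _); apply/idP/forall_inP => [qa i' _|/(_ i iC)]; last by rewrite /Q eqxx.
    by apply/implyP => /eqP ->.
  rewrite (bigD1 i) //=; congr (_ * _).
    apply: eq_bigl => t; rewrite /Q eqxx /=; case: (leqP q t) => qt; rewrite ?andbF //.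
    by rewrite -lt0n (leq_trans q_gt0 qt).
  rewrite (cardsD1 i C) iC /= -prodr_const.
  apply: eq_big => [i'|i' /andP[_ /negbTE ni]]; first by rewrite !inE andbC.
  by apply: eq_bigl => t; rewrite /Q ni andbT lt0n.
transitivity (\sum_(k < q.*2.-1) ('C(k - q.-1, #|C|))%:R : int).
  apply: eq_bigr => k _.
  have kN : (k < N)%N by apply: leq_trans qN.
  have C_gt0 : (0 < #|C|)%N by apply/card_gt0P; exists i.
  rewrite -[in RHS](prednK C_gt0) -(psum_interval_pow _ _ _ kN) (prednK q_gt0) -gen.
  by rewrite psum_sum natr_sum; apply: eq_bigr => a _; rewrite psumXn.
have C_gt0 : (0 < #|C|)%N by apply/card_gt0P; exists i.
rewrite -natr_sum; congr (_%:R).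
(* The thresholds k < q - 1 contribute ['C(0, #|C|)], which is 0 as [C] is nonempty; the remaining q
   are reindexed from 0. *)
have -> : q.*2.-1 = (q.-1 + q)%N by lia.
rewrite big_split_ord /= big1 => [|k _].
  under eq_bigr => k _ do rewrite addKn -[X in 'C(X, _)]addn0.
  by rewrite sum_bin_shift // addn0.
have /eqP -> : (k - q.-1 == 0)%N by rewrite subn_eq0 ltnW.
by rewrite bin_small.
Qed.

Lemma sum_frob_weight q N C : (0 < q)%N -> (q.*2.-1 <= N)%N ->
  (\sum_(a : {ffun 'I_n -> 'I_N} | nzsupp a == C) frob_weight q C a = frob_count q #|C|)%N.
Proof.
move=> q_gt0 qN; have qN' : (q <= N)%N by lia.
rewrite (eq_bigr _ (fun a aC => frob_weight_split q (eqP aC))) big_split /=.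
rewrite /frob_count; congr (_ + _)%N.
  apply/eqP; rewrite -(eqr_nat int) -(@sum_frob_weight_small _ q N) ?q_gt0 //.
  rewrite natr_sum big_mkcondr; apply/eqP; apply: eq_bigr => a _.
  by case: ifP.
rewrite (exchange_big_dep (fun i => i \in C)) /=; last by move=> a i _ /andP[].
rewrite (eq_bigr (fun=> 'C(q, #|C|.+1))); first by rewrite sum_nat_const.
move=> i iC; rewrite -(sum_frob_weight_big q_gt0 qN iC).
by apply: eq_bigl => a; rewrite iC.
Qed.

Lemma card_frob_classesE q : (0 < q)%N ->
  #|frob_classes adj q| =
  (\sum_S \prod_(C in components adj S) frob_count q #|C|)%N.
Proof.
move=> q_gt0; apply/eqP; rewrite -(eqr_nat int) card_frob_classes // !natr_sum; apply/eqP.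
have N_gt0 : (0 < 2 * q * n.+1)%N by nia.
pose G C (a : {ffun 'I_n -> 'I_(2 * q * n.+1)}) : int := (frob_weight q C a)%:R.
have G_local C (a a' : {ffun 'I_n -> 'I_(2 * q * n.+1)}) : {in C, a =1 a'} -> G C a = G C a'.
  move=> e; rewrite /G /frob_weight (deg_on_eq e).
  suff -> : [forall (i | i \in C), (a i < q)%N] = [forall (i | i \in C), (a' i < q)%N] by [].
  by apply: eq_forallb_in => i iC; rewrite e.
under eq_bigr => a _ do rewrite natr_prod.
rewrite (sum_ffun_components adj_sym N_gt0 G_local).
apply: eq_bigr => S _; rewrite natr_prod; apply: eq_bigr => C _.
rewrite -natr_sum sum_frob_weight //; nia.
Qed.

End ExactCounts.

(** * Limits of scaled binomial coefficients and component counts *)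

Section Limits.

Variable F : realType.
Implicit Types (h : nat -> F) (u : nat -> F).

Local Open Scope classical_set_scope.

Lemma cvg_eq (f g : nat -> F) (l l' : F) :
  f =1 g -> l = l' -> g k @[k --> \oo] --> l' -> f k @[k --> \oo] --> l.
Proof. by move=> /funext -> ->. Qed.

Lemma cvg_finsum (I : finType) (P : pred I) (f : I -> nat -> F) (l : I -> F) :
  (forall i, P i -> f i k @[k --> \oo] --> l i) ->
  (\sum_(i | P i) f i k) @[k --> \oo] --> \sum_(i | P i) l i.
Proof. by apply: cvg_big => x; apply: cvgD; [exact: cvg_fst | exact: cvg_snd]. Qed.

Lemma cvg_finprod (I : finType) (P : pred I) (f : I -> nat -> F) (l : I -> F) :
  (forall i, P i -> f i k @[k --> \oo] --> l i) ->
  (\prod_(i | P i) f i k) @[k --> \oo] --> \prod_(i | P i) l i.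
Proof. by apply: cvg_big => x; apply: cvgM; [exact: cvg_fst | exact: cvg_snd]. Qed.

Lemma ffact_natr m j : (m ^_ j)%:R = \prod_(i < j) (m%:R - i%:R) :> F.
Proof.
elim: j => [|j IHj]; first by rewrite ffactn0 big_ord0.
rewrite ffactnSr big_ord_recr /= natrM -IHj.
have [jm|mj] := leqP j m; first by rewrite natrB.
by rewrite ffact_small // !mul0r.
Qed.

Lemma bin_natr m j : 'C(m, j)%:R = (\prod_(i < j) (m%:R - i%:R)) / j`!%:R :> F.
Proof.
rewrite -ffact_natr -bin_ffact natrM mulfK //.
by rewrite pnatr_eq0 -lt0n fact_gt0.
Qed.

(** The hypothesis says that h = 1 / (m - c); one factor h goes to each factor m - i of the falling
    factorial. *)
Lemma bin_scaled m j (c h : F) : m%:R * h = 1 + c * h ->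
  'C(m, j)%:R * h ^+ j = (\prod_(i < j) (1 + (c - i%:R) * h)) / j`!%:R.
Proof.
move=> e; rewrite bin_natr mulrAC -[in h ^+ j](card_ord j) -prodr_const -big_split.
congr (_ / _); apply: eq_bigr => i _ /=.
by rewrite mulrBl e mulrBl addrA.
Qed.

Lemma cvg_bin_scaled (m : nat -> nat) j c h :
  h k @[k --> \oo] --> (0 : F) -> (forall k, (m k)%:R * h k = 1 + c * h k) ->
  ('C(m k, j)%:R * h k ^+ j) @[k --> \oo] --> ((j`!%:R)^-1 : F).
Proof.
move=> h0 e; apply: (cvg_eq (fun k => bin_scaled j (e k)) (esym (mul1r _))).
have prod1 : 1 = \prod_(i < j) 1 :> F by rewrite big1.
apply: cvgMl; apply: (cvg_eq (frefl _) prod1).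
apply: cvg_finprod => i _; apply: (cvg_eq (frefl _) (esym (addr0 1))).
apply: cvgD; first exact: cvg_cst.
by apply: (cvg_eq (frefl _) (esym (mulr0 (c - i%:R)))); apply: cvgMr.
Qed.

Lemma cvg_exp0 h j : h k @[k --> \oo] --> (0 : F) -> (0 < j)%N ->
  (h k ^+ j) @[k --> \oo] --> (0 : F).
Proof.
case: j => // j h0 _; elim: j => [|j IHj]; first exact: (cvg_eq (fun k => expr1 (h k)) erefl).
by apply: (cvg_eq (fun k => exprS (h k) j.+1) (esym (mulr0 0))); apply: cvgM.
Qed.

(** Of the three terms of [frob_count], the first has lower order and tends to 0; the others give s
    / 2 and s / (s + 1)!. *)
Lemma cvg_frob_count (q : nat -> nat) s :
  (forall k, 0 < q k)%N -> (q k)%:R^-1 @[k --> \oo] --> (0 : F) ->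
  ((frob_count (q k) s)%:R * (q k)%:R^-1 ^+ s.+1) @[k --> \oo] -->
    (s%:R / 2%:R + s%:R / (s.+1)`!%:R : F).
Proof.
move=> q_gt0 h0; pose h k : F := (q k)%:R^-1.
have qh k : (q k)%:R * h k = 1 + 0 * h k.
  by rewrite mul0r addr0 /h mulfV // pnatr_eq0 -lt0n.
have q1h k : (q k).-1%:R * h k = 1 - h k.
  rewrite -subn1 natrB // mulrBl mul1r qh mul0r addr0 //.
have pow j : (((q k).-1 ^ j)%:R * h k ^+ j) @[k --> \oo] --> (1 : F).
  have powE k : ((q k).-1 ^ j)%:R * h k ^+ j = (1 - h k) ^+ j.
    by rewrite natrX -exprMn q1h.
  apply: (cvg_eq powE erefl); elim: j {powE} => [|j IHj].
    by apply: (cvg_eq (fun k => expr0 _) erefl); exact: cvg_cst.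
  apply: (cvg_eq (fun k => exprS _ j) (esym (mulr1 1))); apply: cvgM IHj.
  by apply: (cvg_eq (frefl _) (esym (subr0 1))); apply: cvgB => //; exact: cvg_cst.
have binl j := @cvg_bin_scaled q j 0 h h0 qh.
have -> : s%:R / 2%:R + s%:R / (s.+1)`!%:R =
    1 * 0 + s%:R * (1 * 2%:R^-1) + s%:R / (s.+1)`!%:R :> F by rewrite mulr0 add0r mul1r.
have splitE k : (frob_count (q k) s)%:R * h k ^+ s.+1 =
   ((q k).-1 ^ s)%:R * h k ^+ s * h k +
   s%:R * (((q k).-1 ^ s.-1)%:R * h k ^+ s.-1 * ('C(q k, 2)%:R * h k ^+ 2)) +
   s%:R * ('C(q k, s.+1)%:R * h k ^+ s.+1).
  rewrite /frob_count !natrD !natrM !mulrDl; congr (_ + _ + _).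
  - by rewrite exprSr mulrA.
  (* For s = 0 the exponent [s.-1] is truncated, but the factor s makes the term 0. *)
  - case: (s) => [|s']; first by rewrite !mul0r.
    rewrite /= -(addn2 s') exprD -!mulrA; congr (_ * (_ * _)).
    by rewrite mulrCA.
  - by rewrite -mulrA.
apply: (cvg_eq splitE erefl).
apply: cvgD; first apply: cvgD.
- exact: cvgM (pow s) h0.
- apply: cvgMr; apply: cvgM (pow _) _; exact: binl.
- apply: cvgMr; exact: binl.
Qed.

End Limits.

(** * The Krull dimension and the two multiplicities *)

Section Multiplicities.

Variables (n : nat) (adj : rel 'I_n).
Hypothesis adj_sym : ssrbool.symmetric adj.
Implicit Types (S C J : {set 'I_n}).

(** The number of parameters [s_i] and [u_c] attached to [S], equal to n plus the excess by
    [excessE]. *)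
Definition prime_dim S := (#|~: S| + #|components adj S|)%N.
Definition krull_dim := (\max_S prime_dim S)%N.

Lemma prime_dim_le S : (prime_dim S <= krull_dim)%N.
Proof. exact: (leq_bigmax_cond (F := prime_dim)). Qed.

Lemma excessE S : excess adj S = (prime_dim S)%:Z - n%:Z.
Proof.
rewrite /excess /prime_dim; have := cardsC S; rewrite card_ord.
move: #|S| #|~: S| #|components adj S|; lia.
Qed.

Lemma krull_dim_attained : exists S, prime_dim S = krull_dim.
Proof.
have [|S e] := bigop.eq_bigmax prime_dim; last by exists S; rewrite /krull_dim e.
by apply/card_gt0P; exists finset.set0.
Qed.

Lemma max_excess_setsE S : (S \in max_excess_sets adj) = (prime_dim S == krull_dim).
Proof.
have alphaE : alpha adj = krull_dim%:Z - n%:Z.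
  apply/le_anti/andP; split.
    by apply: bigmax_le => [|S' _]; rewrite excessE lerD2r lez_nat prime_dim_le.
  have [S0 <-] := krull_dim_attained; rewrite -excessE.
  exact: (le_bigmax _ (excess adj)).
by rewrite inE alphaE excessE (inj_eq (addIr _)).
Qed.

Lemma leq_bin_exp m j : ('C(m, j) <= m ^ j)%N.
Proof.
apply: (@leq_trans (m ^_ j)); first by rewrite -bin_ffact leq_pmulr // fact_gt0.
elim: j => // j IHj; rewrite ffactnSr expnSr.
by apply: leq_mul => //; apply: leq_subr.
Qed.

Lemma subset_reps_dim S J : J \subset reps adj S -> (#|~: S| + #|J| <= krull_dim)%N.
Proof.
move=> JS; apply: leq_trans (prime_dim_le S).
by rewrite leq_add2l (card_components adj_sym) subset_leq_card.
Qed.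

Lemma card_low_classes_le :
  exists c, forall r, (#|low_classes adj r.+1| <= c * r.+1 ^ krull_dim)%N.
Proof.
(* The constant comes from bounding ['C(r + #|J|, j)] by (r + |J|)^j, and r + |J| by (|J| + 1) (r +
   1). *)
exists (\sum_S \sum_(J : {set 'I_n} | J \subset reps adj S)
  (\prod_(j in J) #|comp_of adj S j|) * (#|J|.+1) ^ krull_dim)%N => r.
rewrite (card_low_classesE adj_sym) big_distrl; apply: leq_sum => S _ /=.
rewrite big_distrl; apply: leq_sum => J JS /=.
rewrite -mulnA leq_mul2l -expnMn; apply/orP; right.
apply: leq_trans (leq_bin_exp _ _) _.
apply: (@leq_trans ((#|J|.+1 * r.+1) ^ (#|~: S| + #|J|))).
  case: (posnP (#|~: S| + #|J|)) => [->|d0]; first by rewrite !expn0.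
  have le a b : (a + b <= b.+1 * a.+1)%N by rewrite mulSn mulnS; lia.
  by rewrite leq_exp2r.
by rewrite leq_pexp2l ?muln_gt0 //; apply: subset_reps_dim.
Qed.

Lemma is_krull_dim_edge_ring (K : fieldType) :
  is_krull_dim (binomial_edge_ring K adj) krull_dim.
Proof.
split.
  by have [S <-] := krull_dim_attained; apply: has_prime_chain_components.
have [c cP] := card_low_classes_le.
apply: (krull_upper_bound adj_sym _ cP) => r.
have [b [_ b_inj b_cov]] := low_classes_family adj_sym r.
by exists _, (low_classes adj r), b.
Qed.

(** Selects the terms of [card_low_classesE] that survive in the limit: every component must
    contribute its pole of higher order. *)
Lemma subset_reps_dim_eq S J : J \subset reps adj S ->
  (#|~: S| + #|J| == krull_dim)%N = (J == reps adj S) && (S \in max_excess_sets adj).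
Proof.
move=> JS; rewrite max_excess_setsE /prime_dim (card_components adj_sym).
have := prime_dim_le S; rewrite /prime_dim (card_components adj_sym) => le_d.
rewrite eqEcard JS /=; have := subset_leq_card JS; move: le_d.
move: #|~: S| #|J| #|reps adj S| krull_dim; lia.
Qed.

Local Open Scope classical_set_scope.

Lemma cvg_low_classes (F : realType) :
  ((krull_dim`! * #|low_classes adj r|)%:R / r%:R ^+ krull_dim) @[r --> \oo] -->
    (\sum_(S in max_excess_sets adj) \prod_(B in components adj S) #|B|%:R : F).
Proof.
(* The shift makes the count formula for [r.+1] applicable and keeps the denominators nonzero. *)
set d := krull_dim; rewrite -cvg_shiftS /=.
pose h k : F := k.+1%:R^-1.
have h0 : h k @[k --> \oo] --> (0 : F) by exact: cvg_harmonic.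
pose w S J : F := (\prod_(j in J) #|comp_of adj S j|)%:R.
have split_sum r : (d`! * #|low_classes adj r.+1|)%:R / r.+1%:R ^+ d =
    \sum_S \sum_(J : {set 'I_n} | J \subset reps adj S)
      d`!%:R * w S J * ('C(r + #|J|, #|~: S| + #|J|)%:R * h r ^+ d).
  rewrite (card_low_classesE adj_sym) natrM natr_sum -mulrA mulr_suml mulr_sumr.
  apply: eq_bigr => S _; rewrite natr_sum mulr_suml mulr_sumr.
  by apply: eq_bigr => J _; rewrite natrM exprVn !mulrA.
have lim_sum : \sum_(S in max_excess_sets adj) \prod_(B in components adj S) #|B|%:R =
    \sum_S \sum_(J : {set 'I_n} | J \subset reps adj S)
      d`!%:R * w S J * (if (#|~: S| + #|J| == d)%N then (d`!%:R)^-1 else 0) :> F.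
  rewrite big_mkcond; apply: eq_bigr => S _.
  rewrite [RHS](bigD1 (reps adj S)) //= [X in _ + X]big1 => [|J /andP[JS ne]]; last first.
    by rewrite subset_reps_dim_eq // (negbTE ne) mulr0.
  rewrite subset_reps_dim_eq // eqxx addr0 /=; case: ifP => _; last by rewrite mulr0.
  rewrite mulrAC mulfV ?mul1r; last by rewrite pnatr_eq0 -lt0n fact_gt0.
  by rewrite (big_components adj_sym) /w natr_prod.
apply: (cvg_eq split_sum lim_sum); apply: cvg_finsum => S _.
apply: cvg_finsum => J JS; apply: cvgMr.
(* With h = 1 / (r + 1), the constant c of [cvg_bin_scaled] is |J| - 1. *)
have rh r : (r + #|J|)%:R * h r = 1 + (#|J|%:R - 1) * h r.
  have r1 : r.+1%:R * h r = 1 by rewrite mulfV // pnatr_eq0.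
  have rE : r%:R * h r = 1 - h r by rewrite -[r%:R](addrK 1) natr1 mulrBl r1 mul1r.
  by rewrite natrD mulrDl rE mulrBl mul1r -addrA [- _ + _]addrC.
have limJ := @cvg_bin_scaled F (fun r => r + #|J|)%N (#|~: S| + #|J|)%N _ h h0 rh.
case: eqP => [<- //|/eqP ne].
have lt_d : (#|~: S| + #|J| < d)%N by rewrite ltn_neqAle ne subset_reps_dim.
have e r : 'C(r + #|J|, #|~: S| + #|J|)%:R * h r ^+ d =
    'C(r + #|J|, #|~: S| + #|J|)%:R * h r ^+ (#|~: S| + #|J|) *
    h r ^+ (d - (#|~: S| + #|J|)).
  by rewrite -mulrA -exprD subnKC // ltnW.
apply: (cvg_eq e (esym (mulr0 _))); apply: cvgM limJ _.
by apply: cvg_exp0; rewrite // subn_gt0.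
Qed.

(** With q = p^k, each component B absorbs q^-(|B| + 1). The remaining factor q^-(d - [prime_dim S])
    is 1 for sets of maximal excess and tends to 0 for the others. *)
Lemma cvg_frob_classes (F : realType) p : prime p ->
  (#|frob_classes adj (p ^ k)|%:R / p%:R ^+ (k * krull_dim)) @[k --> \oo] -->
    (\sum_(S in max_excess_sets adj) \prod_(B in components adj S)
       (#|B|%:R / 2%:R + #|B|%:R / (#|B|.+1)`!%:R) : F).
Proof.
move=> p_pr; set d := krull_dim; have p_gt0 := prime_gt0 p_pr.
have q_gt0 k : (0 < p ^ k)%N by rewrite expn_gt0 p_gt0.
pose h k : F := (p ^ k)%:R^-1.
have h0 : h k @[k --> \oo] --> (0 : F).
  apply: (@cvg_eq _ _ (fun k => p%:R^-1 ^+ k) _ 0) => // [k|].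
    by rewrite /h natrX exprVn.
  apply: cvg_expr; rewrite ger0_norm ?invr_ge0 ?ler0n // invf_lt1 ?ltr0n //.
  by rewrite ltr1n prime_gt1.
have split_sum k : #|frob_classes adj (p ^ k)|%:R / p%:R ^+ (k * d) =
    \sum_S (\prod_(B in components adj S)
      ((frob_count (p ^ k) #|B|)%:R * h k ^+ #|B|.+1)) * h k ^+ (d - prime_dim S).
  rewrite (card_frob_classesE adj_sym) // exprM -natrX natr_sum mulr_suml.
  apply: eq_bigr => S _; rewrite -exprVn -/(h k) natr_prod big_split /= prodrXr -mulrA -exprD.
  congr (_ * _ ^+ _).
  suff -> : (\sum_(B in components adj S) #|B|.+1 = prime_dim S)%N by rewrite subnKC ?prime_dim_le.
  rewrite (big_components adj_sym) /prime_dim -(sum_card_comp_of adj_sym).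
  rewrite (card_components adj_sym) -sum1_card -big_split.
  by apply: eq_bigr => j _; rewrite /= addn1.
have lim_sum : \sum_(S in max_excess_sets adj) \prod_(B in components adj S)
       (#|B|%:R / 2%:R + #|B|%:R / (#|B|.+1)`!%:R) =
    \sum_S \prod_(B in components adj S) (#|B|%:R / 2%:R + #|B|%:R / (#|B|.+1)`!%:R) *
      (if S \in max_excess_sets adj then 1 else 0) :> F.
  rewrite big_mkcond; apply: eq_bigr => S _.
  by case: ifP; rewrite ?mulr1 ?mulr0.
apply: (cvg_eq split_sum lim_sum); apply: cvg_finsum => S _; apply: cvgM.
  by apply: cvg_finprod => B _; apply: cvg_frob_count.
rewrite max_excess_setsE; case: eqP => [->|/eqP ne].
  apply: (@cvg_eq _ _ (fun=> 1) _ 1) => // [k|]; last exact: cvg_cst.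
  by rewrite subnn expr0.
by apply: cvg_exp0; rewrite // subn_gt0 ltn_neqAle ne prime_dim_le.
Qed.

End Multiplicities.

Theorem theorem4p4 (F : realType) (K : fieldType) (n : nat) (adj : rel 'I_n)
    (adj_sym : ssrbool.symmetric adj) (adj_irr : irreflexive adj) :
  is_hilbert_samuel_mult (binomial_edge_max K adj)
    (\sum_(S in max_excess_sets adj)
        \prod_(B in components adj S) #|B|%:R : F) /\
  (forall p : nat, p \in [pchar K] ->
    is_hilbert_kunz_mult p (binomial_edge_max K adj)
      (\sum_(S in max_excess_sets adj)
          \prod_(B in components adj S)
             (#|B|%:R / 2%:R + #|B|%:R / (#|B|.+1)`!%:R) : F)).
Proof.
split; [|move=> p pK]; (exists (krull_dim adj); first exact: is_krull_dim_edge_ring).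
- exists (fun r => #|low_classes adj r|) => [r|]; last exact: cvg_low_classes.
  have [c [c_deg c_inj c_cov]] := low_classes_family adj_sym r.
  exact: (expn_edge_max_dim K adj_sym c_deg c_inj c_cov).
have p_pr := pcharf_prime pK.
exists (fun k => #|frob_classes adj (p ^ k)|) => [k|]; last exact: cvg_frob_classes.
have q_gt0 : (0 < p ^ k)%N by rewrite expn_gt0 prime_gt0.
have [c [c_N c_inj c_cov]] := frob_classes_family adj_sym q_gt0.
exact: (frobenius_edge_max_dim adj_sym pK c_N c_inj c_cov).
Qed.
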